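(* Let $f\in F$ be a non-identity element. (1) If the current tree of $f$ is nontrivial, then $\ell(x_1^{-1}f)<\ell(f)$ or $\ell(x_0f)<\ell(f)$. (2) If left-multiplication by $x_1$ would cancel a caret of the bottom forest (i.e. in the reduced forest diagram of $f$ the top trees $T_0,T_1$ are both trivial and their leaves are the two leaf children of a single bottom caret), then $\ell(x_1f)<\ell(f)$. (3) Otherwise (the current tree is trivial and left-multiplication by $x_1$ would not cancel a bottom caret), $\ell(x_0f)<\ell(f)$ or $\ell(x_0^{-1}f)<\ell(f)$.
   Context: Thompson's group $F$ is realized as the group of all orientation-preserving piecewise-linear homeomorphisms $f$ of $\mathbb R$ with finitely many breakpoints, all breakpoints having dyadic rational coordinates, all slopes integral powers of $2$, and with $f(t)=t-m$ for all sufficiently negative $t$ and $f(t)=t-n$ for all sufficiently positive $t$, for some integers $m,n$. Products are compositions of functions: $fg=f\circ g$. The generators are $x_0(t)=t-1$ and $x_1(t)=t$ for $t\le 0$, $x_1(t)=t/2$ for $0\le t\le 2$, $x_1(t)=t-1$ for $t\ge 2$. Forest diagrams: a binary forest is a sequence $(T_i)_{i\in\mathbb Z}$ of finite rooted binary trees (every node has $0$ or $2$ children; internal nodes are called carets; a trivial tree is a single leaf), all but finitely many trivial, together with a pointer marking $T_0$. Tree $T_i$ represents the interval $[i,i+1]$, each caret represents halving the interval of its node, and the leaves of the forest give a dyadic subdivision of $\mathbb R$. A forest diagram for $f$ is a pair of binary forests, the bottom (domain) forest with subdivision $\mathcal D$ and the top (range) forest with subdivision $\mathcal R$, such that $f$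 maps each interval of $\mathcal D$ linearly onto an interval of $\mathcal R$; this matches the leaves of the two forests by an order-preserving bijection, so the two forests share one linearly ordered set of leaves (columns). A reduction deletes an opposing pair of carets, i.e. a top caret and a bottom caret both of whose children are leaves and which have the same two (matched) leaves. A forest diagram is reduced if no reduction is possible; every element of $F$ has a unique reduced forest diagram. The support of a forest diagram is the smallest set of consecutive columns containing all leaves of nontrivial trees of either forest and the leaves of the two trees marked by the two pointers. A space is a gap between two consecutive columns; the spaces in the support are the gaps between consecutive columns of the support. The current tree of $f$ is the tree of the top forest (of the reduced diagram) marked by the top pointer. Labels: in each of the two forests separately (using that forest's own pointer), a space is interior if the leaves on both sides of it belong to the same tree and exterior otherwise; it lies immediately to the left of a caret $c$ of that forest if the leaf immediately to its right is the leftmost leaf descending from $c$. Each space of the support receives a label in each forest: $L$ if it is exterior and to the left of the tree marked by the pointer; otherwise $N$ if it lies immediately to the left of some caret; otherwise $R$ if it is exterior (hence to the right of the marked tree); otherwise $I$ (interior). A space thus has a label pair (top label, bottom label). Weights, by (top, bottom): $(L,L)=2$, $(L,N)=1$, $(L,R)=1$, $(L,I)=1$; $(N,L)=1$, $(N,N)=2$, $(N,R)=2$, $(N,I)=2$; $(R,L)=1$, $(R,N)=2$, $(R,R)=2$, $(R,I)=0$; $(I,L)=1$, $(I,N)=2$, $(I,R)=0$, $(I,I)=0$. For $f\in F$, $\ell(f)=\ell_0(f)+\ell_1(f)$, where $\ell_0(f)$ is the sum of the weights of the spaces in the support of the reduced forest diagram of $f$ and $\ell_1(f)$ is its total number of carets.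 *)

(* Defs.v *)
From Stdlib Require Import Reals ZArith List Lia Lra ClassicalEpsilon ClassicalDescription.
Import ListNotations.
Open Scope R_scope.

Definition dyadic (x : R) : Prop := exists (k : Z) (n : nat), x = IZR k / 2 ^ n.

(* f is in F: there is a finite increasing list of dyadic breakpoints (with dyadic
   images), f is affine with slope a power of 2 between consecutive breakpoints, and
   f(t) = t - m left of all breakpoints, f(t) = t - n right of all breakpoints.
   (Such f is automatically a continuous, orientation-preserving homeomorphism.) *)
Definition inF (f : R -> R) : Prop :=
  exists (bs : list R) (m n : Z),
    (forall i, (S i < length bs)%nat -> nth i bs 0 < nth (S i) bs 0) /\
    (forall b, In b bs -> dyadic b /\ dyadic (f b)) /\
    (forall i, (S i < length bs)%nat -> exists z : Z, forall t,
        nth i bs 0 <= t <= nth (S i) bs 0 ->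
        f t = f (nth i bs 0) + powerRZ 2 z * (t - nth i bs 0)) /\
    (forall t, (forall b, In b bs -> t <= b) -> f t = t - IZR m) /\
    (forall t, (forall b, In b bs -> b <= t) -> f t = t - IZR n).

Definition x0 (t : R) : R := t - 1.
Definition x0inv (t : R) : R := t + 1.
Definition x1 (t : R) : R :=
  if Rle_dec t 0 then t else if Rle_dec t 2 then t / 2 else t - 1.
Definition x1inv (t : R) : R :=
  if Rle_dec t 0 then t else if Rle_dec t 1 then 2 * t else t + 1.

Inductive tree : Type := Leaf | Node (l r : tree).

Fixpoint tleaves (t : tree) (a b : R) : list (R * R) :=
  match t with
  | Leaf => [(a, b)]
  | Node l r => tleaves l a ((a + b) / 2) ++ tleaves r ((a + b) / 2) b
  end.

Fixpoint tcarets (t : tree) (a b : R) : list (R * R) :=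
  match t with
  | Leaf => []
  | Node l r => (a, b) :: tcarets l a ((a + b) / 2) ++ tcarets r ((a + b) / 2) b
  end.

Fixpoint tecarets (t : tree) (a b : R) : list (R * R) :=
  match t with
  | Leaf => []
  | Node Leaf Leaf => [(a, b)]
  | Node l r => tecarets l a ((a + b) / 2) ++ tecarets r ((a + b) / 2) b
  end.

Fixpoint tsize (t : tree) : nat :=
  match t with Leaf => 0%nat | Node l r => S (tsize l + tsize r) end.

(* A binary forest (T_i)_{i in Z}: T_i is the (i - flo)-th tree of the list ftrees
   if it exists, and trivial otherwise. T_i represents [i, i+1]; the pointer marks T_0. *)
Record forest := { flo : Z; ftrees : list tree }.

Definition ftree (F : forest) (i : Z) : tree :=
  if (i <? flo F)%Z then Leaf else nth (Z.to_nat (i - flo F)) (ftrees F) Leaf.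

Definition in_tree (F : forest) (i : Z) (a b : R) : Prop :=
  In (a, b) (tleaves (ftree F i) (IZR i) (IZR i + 1)).

Definition is_leaf (F : forest) (a b : R) : Prop := exists i : Z, in_tree F i a b.

Definition is_caret (F : forest) (a b : R) : Prop :=
  exists i : Z, In (a, b) (tcarets (ftree F i) (IZR i) (IZR i + 1)).

Definition is_ecaret (F : forest) (a b : R) : Prop :=
  exists i : Z, In (a, b) (tecarets (ftree F i) (IZR i) (IZR i + 1)).

Definition ncarets (F : forest) : nat := fold_right (fun t n => (tsize t + n)%nat) 0%nat (ftrees F).

Record fdiag := { dbot : forest; dtop : forest }.

Definition diagram_of (D : fdiag) (f : R -> R) : Prop :=
  forall a b, is_leaf (dbot D) a b ->
    is_leaf (dtop D) (f a) (f b) /\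
    forall t, a <= t <= b -> f t = f a + (t - a) * (f b - f a) / (b - a).

Definition reduced (D : fdiag) (f : R -> R) : Prop :=
  ~ exists a b c d, is_ecaret (dbot D) a b /\ is_ecaret (dtop D) c d /\
      f a = c /\ f ((a + b) / 2) = (c + d) / 2 /\ f b = d.

Definition reduced_diagram_of (D : fdiag) (f : R -> R) : Prop :=
  diagram_of D f /\ reduced D f.

(* a column (bottom leaf [a,b], matched with top leaf [f a, f b]) that must lie in
   the support: it is a leaf of a nontrivial tree or of the pointed tree T_0 in
   either forest *)
Definition required_col (D : fdiag) (f : R -> R) (a b : R) : Prop :=
  (exists i, in_tree (dbot D) i a b /\ (ftree (dbot D) i <> Leaf \/ i = 0%Z)) \/
  (exists i, in_tree (dtop D) i (f a) (f b) /\ (ftree (dtop D) i <> Leaf \/ i = 0%Z)).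

(* spaces are identified with the boundary point p between two consecutive bottom
   leaves (domain coordinate); in the top forest the same space is at f p. *)
Definition support_space (D : fdiag) (f : R -> R) (p : R) : Prop :=
  (exists a, is_leaf (dbot D) a p) /\
  (exists a1 b1, required_col D f a1 b1 /\ a1 < p) /\
  (exists a2 b2, required_col D f a2 b2 /\ p < b2).

Inductive label := LL | NN | RR | II.

Definition exterior (x : R) : Prop := exists i : Z, x = IZR i.
(* exterior space to the left of T_0 = [0,1] *)
Definition left_exterior (x : R) : Prop := exists i : Z, x = IZR i /\ (i <= 0)%Z.
(* the leaf immediately to the right of x is the leftmost leaf of some caret,
   i.e. some caret's interval has left endpoint x *)
Definition left_of_caret (F : forest) (x : R) : Prop := exists c, is_caret F x c.

Definition dec (P : Prop) : bool := if excluded_middle_informative P then true else false.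

Definition label_of (F : forest) (x : R) : label :=
  if dec (left_exterior x) then LL
  else if dec (left_of_caret F x) then NN
  else if dec (exterior x) then RR
  else II.

Definition weight (top bot : label) : nat :=
  match top, bot with
  | LL, LL => 2 | LL, NN => 1 | LL, RR => 1 | LL, II => 1
  | NN, LL => 1 | NN, NN => 2 | NN, RR => 2 | NN, II => 2
  | RR, LL => 1 | RR, NN => 2 | RR, RR => 2 | RR, II => 0
  | II, LL => 1 | II, NN => 2 | II, RR => 0 | II, II => 0
  end.

Definition space_weight (D : fdiag) (f : R -> R) (p : R) : nat :=
  weight (label_of (dtop D) (f p)) (label_of (dbot D) p).

Definition diag_length (D : fdiag) (f : R -> R) (n : nat) : Prop :=
  exists ps : list R, NoDup ps /\ (forall p, In p ps <-> support_space D f p) /\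
    n = (fold_right (fun p s => (space_weight D f p + s)%nat) 0%nat ps
         + ncarets (dbot D) + ncarets (dtop D))%nat.

(* l(f), computed from the (unique) reduced forest diagram of f *)
Definition ell (f : R -> R) : nat :=
  epsilon (inhabits 0%nat) (fun n => exists D, reduced_diagram_of D f /\ diag_length D f n).

Definition x1_cancels (D : fdiag) (f : R -> R) : Prop :=
  ftree (dtop D) 0 = Leaf /\ ftree (dtop D) 1 = Leaf /\
  exists a b, is_ecaret (dbot D) a b /\ f a = 0 /\ f ((a + b) / 2) = 1 /\ f b = 2.

(* Main.v *)
(* Each of the three moves changes the reduced diagram in a controlled way:
   x_0^{+-1} moves the top pointer, x_1^{-1} deletes the root caret of the current
   tree, and a cancelling x_1 deletes an exposed bottom caret.  The length of the
   new diagram is compared with the old one space by space: in all cases the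
   support does not grow and at most one space changes weight.  When deleting the
   root caret does not help, the space below it has become (R, R), and then the
   space to the right of the current tree has bottom label N or R, so that x_0
   lowers its weight.  When the current tree is trivial, inspecting the two spaces
   around it shows that one pointer move lowers the length, unless the two spaces
   exhibit a cancelling bottom caret or f is the identity.

   Reduced diagrams are unique because a bottom leaf of one diagram that is an
   inner node of another is mapped onto a node of the other top forest carrying
   the same subtree, whose exposed carets then oppose each other. *)
Require Import Defs.
From Stdlib Require Import Reals ZArith List Lra Lia Classical.
From Stdlib Require Import ClassicalEpsilon ClassicalDescription FunctionalExtensionality.
Import ListNotations.
Open Scope R_scope.

(** * Binary trees *)

(** All moves multiply on the left, so, apart from one pruned caret, the bottom forest and the
    domain coordinates of the spaces survive, and old and new weights are compared at the same point
    [p] of the domain. The weight table decides which pointer move helps. Moving right turns the top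
    label N or R of the space right of the current tree into L: the weight falls from 2 to 1 for
    bottom N or R and for the pair (N,I), but rises for bottom L and for (R,I). Moving left across a
    trivial tree turns L into R at the space on its left: the weight falls for bottom L or I and
    rises for N or R. When the current tree is trivial these two spaces are the ends of a single
    bottom leaf, which links their bottom labels; where a label change would raise the weight, the
    space is shown to leave the support instead. Since [ell] is chosen by [epsilon], uniqueness of
    reduced diagrams is what allows it to be read off from whichever reduced diagram is at hand. *)

Lemma unit_disjoint (i j : Z) : i <> j -> IZR i + 1 <= IZR j \/ IZR j + 1 <= IZR i.
Proof.
  intros H. destruct (Z_lt_ge_dec i j) as [h | h].
  - left. rewrite <- plus_IZR. apply IZR_le. lia.
  - right. rewrite <- plus_IZR. apply IZR_le. lia.
Qed.

Lemma unit_cover_l (t : R) : exists i : Z, IZR i <= t < IZR i + 1.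
Proof. exists (Int_part t). destruct (base_Int_part t). lra. Qed.

Lemma unit_cover_r (t : R) : exists i : Z, IZR i < t <= IZR i + 1.
Proof.
  destruct (unit_cover_l (- t)) as [i Hi]. exists (- i - 1)%Z.
  rewrite minus_IZR, opp_IZR. lra.
Qed.

Lemma tleaves_bounds T : forall x y a b, x < y -> In (a, b) (tleaves T x y) ->
  x <= a /\ a < b /\ b <= y.
Proof.
  induction T as [|l IHl r IHr]; simpl; intros x y a b Hxy H.
  - destruct H as [H|[]]. injection H; intros; subst. lra.
  - apply in_app_iff in H as [H|H].
    + apply IHl in H; lra.
    + apply IHr in H; lra.
Qed.

Lemma tcarets_bounds T : forall x y a b, x < y -> In (a, b) (tcarets T x y) ->
  x <= a /\ a < b /\ b <= y.
Proof.
  induction T as [|l IHl r IHr]; simpl; intros x y a b Hxy H.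
  - destruct H.
  - destruct H as [H|H]; [injection H; intros; subst; lra|].
    apply in_app_iff in H as [H|H].
    + apply IHl in H; lra.
    + apply IHr in H; lra.
Qed.

Lemma tleaves_disjoint T : forall x y a b c d, x < y ->
  In (a, b) (tleaves T x y) -> In (c, d) (tleaves T x y) ->
  (a = c /\ b = d) \/ b <= c \/ d <= a.
Proof.
  induction T as [|l IHl r IHr]; simpl; intros x y a b c d Hxy H1 H2.
  - destruct H1 as [H1|[]], H2 as [H2|[]]. injection H1; injection H2; intros; subst. auto.
  - apply in_app_iff in H1, H2.
    destruct H1 as [H1|H1], H2 as [H2|H2].
    + apply (IHl x ((x + y) / 2)); auto; lra.
    + apply tleaves_bounds in H1; [|lra]. apply tleaves_bounds in H2; [|lra]. lra.
    + apply tleaves_bounds in H1; [|lra]. apply tleaves_bounds in H2; [|lra]. lra.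
    + apply (IHr ((x + y) / 2) y); auto; lra.
Qed.

Lemma tleaves_cover_l T : forall x y t, x <= t < y ->
  exists a b, In (a, b) (tleaves T x y) /\ a <= t < b.
Proof.
  induction T as [|l IHl r IHr]; simpl; intros x y t H.
  - exists x, y. auto.
  - destruct (Rlt_le_dec t ((x + y) / 2)) as [h|h].
    + destruct (IHl x ((x + y) / 2) t) as (a & b & Hab & Ht); [lra|].
      exists a, b. rewrite in_app_iff. auto.
    + destruct (IHr ((x + y) / 2) y t) as (a & b & Hab & Ht); [lra|].
      exists a, b. rewrite in_app_iff. auto.
Qed.

Lemma tleaves_cover_r T : forall x y t, x < t <= y ->
  exists a b, In (a, b) (tleaves T x y) /\ a < t <= b.
Proof.
  induction T as [|l IHl r IHr]; simpl; intros x y t H.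
  - exists x, y. auto.
  - destruct (Rle_lt_dec t ((x + y) / 2)) as [h|h].
    + destruct (IHl x ((x + y) / 2) t) as (a & b & Hab & Ht); [lra|].
      exists a, b. rewrite in_app_iff. auto.
    + destruct (IHr ((x + y) / 2) y t) as (a & b & Hab & Ht); [lra|].
      exists a, b. rewrite in_app_iff. auto.
Qed.

Lemma tleaves_full T x y : x < y -> In (x, y) (tleaves T x y) -> T = Leaf.
Proof.
  destruct T as [|l r]; simpl; intros Hxy H; [reflexivity|].
  apply in_app_iff in H as [H|H]; apply tleaves_bounds in H; lra.
Qed.

Lemma tcarets_root T x y : T <> Leaf -> In (x, y) (tcarets T x y).
Proof. destruct T; simpl; tauto. Qed.

Lemma tcarets_node l r x y q : In q (tcarets (Node l r) x y) <->
  q = (x, y) \/ In q (tcarets l x ((x + y) / 2)) \/ In q (tcarets r ((x + y) / 2) y).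
Proof. simpl. rewrite in_app_iff. intuition. Qed.

Lemma leaf_in_caret T : forall x y u v c, x < y ->
  In (u, v) (tleaves T x y) -> In (u, c) (tcarets T x y) -> v < c.
Proof.
  induction T as [|l IHl r IHr]; simpl; intros x y u v c Hxy Hl Hc; [tauto|].
  rewrite in_app_iff in Hl, Hc.
  assert (Hm : x < (x + y) / 2 < y) by lra.
  destruct Hc as [Hc|[Hc|Hc]].
  - injection Hc; intros; subst.
    destruct Hl as [Hl|Hl]; apply tleaves_bounds in Hl; lra.
  - destruct Hl as [Hl|Hl]; [apply (IHl x ((x + y) / 2) u v c); auto; lra|].
    apply tleaves_bounds in Hl; [|lra]. apply tcarets_bounds in Hc; lra.
  - destruct Hl as [Hl|Hl]; [|apply (IHr ((x + y) / 2) y u v c); auto; lra].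
    apply tleaves_bounds in Hl; [|lra]. apply tcarets_bounds in Hc; lra.
Qed.

Lemma tecarets_node l r x y q : In q (tecarets (Node l r) x y) <->
  (l = Leaf /\ r = Leaf /\ q = (x, y)) \/
  In q (tecarets l x ((x + y) / 2)) \/ In q (tecarets r ((x + y) / 2) y).
Proof.
  assert (E : (l = Leaf /\ r = Leaf) \/ tecarets (Node l r) x y =
    tecarets l x ((x + y) / 2) ++ tecarets r ((x + y) / 2) y).
  { destruct l; [destruct r|]; auto. }
  assert (E' : (l = Leaf /\ r = Leaf) \/ (l <> Leaf \/ r <> Leaf)).
  { destruct l; [destruct r|]; auto; right; [right|left]; discriminate. }
  destruct E' as [[-> ->]|Hn].
  - simpl. split.
    + intros [<-|[]]. auto.
    + intros [(_ & _ & ->)|[[]|[]]]; auto.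
  - destruct E as [[-> ->]|E]; [tauto|]. rewrite E, in_app_iff.
    split; [tauto|]. intros [(-> & -> & _)|?]; tauto.
Qed.

Lemma tecarets_halves T : forall x y a b, In (a, b) (tecarets T x y) ->
  In (a, (a + b) / 2) (tleaves T x y) /\ In ((a + b) / 2, b) (tleaves T x y).
Proof.
  induction T as [|l IHl r IHr]; intros x y a b H; [destruct H|].
  apply tecarets_node in H as [(-> & -> & H)|[H|H]].
  - injection H; intros; subst. simpl. auto.
  - apply IHl in H. simpl. rewrite !in_app_iff. tauto.
  - apply IHr in H. simpl. rewrite !in_app_iff. tauto.
Qed.

Lemma tecarets_exists T : forall x y, T <> Leaf -> exists a b, In (a, b) (tecarets T x y).
Proof.
  induction T as [|l IHl r IHr]; intros x y H; [tauto|].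
  destruct l as [|l1 l2]; [destruct r as [|r1 r2]|].
  - exists x, y. simpl. auto.
  - destruct (IHr ((x + y) / 2) y) as (a & b & Hab); [discriminate|].
    exists a, b. rewrite tecarets_node. auto.
  - destruct (IHl x ((x + y) / 2)) as (a & b & Hab); [discriminate|].
    exists a, b. rewrite tecarets_node. auto.
Qed.

(** Being leftmost below some caret makes the leaf a left child. Its sibling starts at [v], where no
    caret starts, so the sibling is a leaf too and the parent is exposed. *)
Lemma leaf_pair_ecaret T : forall x y u v, x < y ->
  In (u, v) (tleaves T x y) ->
  (exists c, In (u, c) (tcarets T x y)) ->
  (forall c, ~ In (v, c) (tcarets T x y)) ->
  exists b, In (u, b) (tecarets T x y) /\ v = (u + b) / 2.
Proof.
  induction T as [|l IHl r IHr]; intros x y u v Hxy Hl [c Hc] Hn; [destruct Hc|].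
  assert (Hm : x < (x + y) / 2 < y) by lra.
  simpl in Hl. apply in_app_iff in Hl as [Hl|Hl].
  - pose proof (tleaves_bounds _ _ _ _ _ (proj1 Hm) Hl) as B.
    destruct l as [|l1 l2].
    + destruct Hl as [Hl|[]]. injection Hl; intros; subst.
      destruct r as [|r1 r2].
      * exists y. simpl. auto.
      * exfalso. apply (Hn y). simpl. auto.
    + destruct (IHl x ((x + y) / 2) u v) as (b & Hb & Hv); auto; try lra.
      * apply tcarets_node in Hc as [Hc|[Hc|Hc]].
        -- injection Hc; intros; subst. eexists. apply tcarets_root. discriminate.
        -- exists c; exact Hc.
        -- apply tcarets_bounds in Hc; lra.
      * intros c' Hc'. apply (Hn c'). apply tcarets_node. auto.
      * exists b. rewrite tecarets_node. auto.
  - pose proof (tleaves_bounds _ _ _ _ _ (proj2 Hm) Hl) as B.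
    destruct (IHr ((x + y) / 2) y u v) as (b & Hb & Hv); auto; try lra.
    + exists c. simpl in Hc. destruct Hc as [Hc|Hc]; [injection Hc; intros; lra|].
      apply in_app_iff in Hc as [Hc|Hc]; [|exact Hc].
      exfalso. apply tcarets_bounds in Hc as Bc; [|lra].
      lra.
    + intros c' Hc'. apply (Hn c'). simpl. rewrite in_app_iff. auto.
    + exists b. rewrite tecarets_node. auto.
Qed.

(** * Transport of trees along maps that preserve midpoints *)

Definition pair_map (L : R -> R) (q : R * R) : R * R := (L (fst q), L (snd q)).

(** Trees subdivide by midpoints only, so this property is enough to carry the leaves and carets of
    a tree over one interval to those over another. It covers the translations, the doubling and
    halving in [x1inv] and [x1], and the affine pieces of [f]. *)
Definition midpoint_affine (L : R -> R) : Prop :=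
  forall s t, L ((s + t) / 2) = (L s + L t) / 2.

Lemma tleaves_affine L T : midpoint_affine L -> forall x y,
  tleaves T (L x) (L y) = map (pair_map L) (tleaves T x y).
Proof.
  intros HL. induction T as [|l IHl r IHr]; intros x y; simpl; [reflexivity|].
  rewrite map_app, <- IHl, <- IHr, HL. reflexivity.
Qed.

Lemma tcarets_affine L T : midpoint_affine L -> forall x y,
  tcarets T (L x) (L y) = map (pair_map L) (tcarets T x y).
Proof.
  intros HL. induction T as [|l IHl r IHr]; intros x y; simpl; [reflexivity|].
  rewrite map_app, <- IHl, <- IHr, HL. reflexivity.
Qed.

Lemma tecarets_affine L T : midpoint_affine L -> forall x y,
  tecarets T (L x) (L y) = map (pair_map L) (tecarets T x y).
Proof.
  intros HL. induction T as [|l IHl r IHr]; intros x y; [reflexivity|].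
  destruct l as [|l1 l2]; [destruct r as [|r1 r2]|]; [reflexivity| |];
    cbn -[tecarets]; change (tecarets (Node ?l ?r) ?x ?y) with
      (tecarets l x ((x + y) / 2) ++ tecarets r ((x + y) / 2) y);
    rewrite map_app, <- IHl, <- IHr, HL; reflexivity.
Qed.

Lemma in_map_pair L a b l : In (a, b) (map (pair_map L) l) <->
  exists a' b', In (a', b') l /\ a = L a' /\ b = L b'.
Proof.
  rewrite in_map_iff. split.
  - intros ([a' b'] & E & H). injection E; simpl; intros. exists a', b'. auto.
  - intros (a' & b' & H & -> & ->). exists (a', b'). auto.
Qed.

Lemma tleaves_image L T x y x' y' a b : midpoint_affine L -> x' = L x -> y' = L y ->
  In (a, b) (tleaves T x' y') <->
  exists a' b', In (a', b') (tleaves T x y) /\ a = L a' /\ b = L b'.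
Proof. intros HL -> ->. rewrite tleaves_affine by exact HL. apply in_map_pair. Qed.

Lemma tcarets_image L T x y x' y' a b : midpoint_affine L -> x' = L x -> y' = L y ->
  In (a, b) (tcarets T x' y') <->
  exists a' b', In (a', b') (tcarets T x y) /\ a = L a' /\ b = L b'.
Proof. intros HL -> ->. rewrite tcarets_affine by exact HL. apply in_map_pair. Qed.

Lemma tecarets_image L T x y x' y' a b : midpoint_affine L -> x' = L x -> y' = L y ->
  In (a, b) (tecarets T x' y') <->
  exists a' b', In (a', b') (tecarets T x y) /\ a = L a' /\ b = L b'.
Proof. intros HL -> ->. rewrite tecarets_affine by exact HL. apply in_map_pair. Qed.

(** Inclusion already forces equality because both lists of leaves tile the same interval. *)
Lemma tleaves_incl_eq s : forall s' x y, x < y ->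
  incl (tleaves s x y) (tleaves s' x y) -> s = s'.
Proof.
  induction s as [|l IHl r IHr]; intros s' x y Hxy H.
  - symmetry. apply (tleaves_full s' x y Hxy). apply H. simpl; auto.
  - assert (Hm : x < (x + y) / 2 < y) by lra.
    destruct s' as [|l' r'].
    + destruct (tleaves_cover_l l x ((x + y) / 2) x) as (a & b & Hab & _); [lra|].
      assert (H' : In (a, b) (tleaves Leaf x y)).
      { apply H. simpl. apply in_app_iff. auto. }
      destruct H' as [H'|[]]. injection H'; intros; subst.
      apply tleaves_bounds in Hab; lra.
    + f_equal.
      * apply (IHl l' x ((x + y) / 2)); [lra|]. intros [a b] Hab.
        assert (H' : In (a, b) (tleaves (Node l' r') x y)).
        { apply H. simpl. apply in_app_iff. auto. }
        simpl in H'. apply in_app_iff in H' as [H'|H']; [exact H'|].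
        apply tleaves_bounds in Hab; [|lra]. apply tleaves_bounds in H'; lra.
      * apply (IHr r' ((x + y) / 2) y); [lra|]. intros [a b] Hab.
        assert (H' : In (a, b) (tleaves (Node l' r') x y)).
        { apply H. simpl. apply in_app_iff. auto. }
        simpl in H'. apply in_app_iff in H' as [H'|H']; [|exact H'].
        apply tleaves_bounds in Hab; [|lra]. apply tleaves_bounds in H'; lra.
Qed.

(** * Subtrees at given positions, and pruning *)

Fixpoint subtree_at (T : tree) (x y : R) (s : tree) (a b : R) : Prop :=
  (s = T /\ a = x /\ b = y) \/
  match T with
  | Leaf => False
  | Node l r => subtree_at l x ((x + y) / 2) s a b \/ subtree_at r ((x + y) / 2) y s a b
  end.

Lemma subtree_leaves T : forall x y s a b q, subtree_at T x y s a b ->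
  In q (tleaves s a b) -> In q (tleaves T x y).
Proof.
  induction T as [|l IHl r IHr]; simpl; intros x y s a b q H Hq.
  - destruct H as [(-> & -> & ->)|[]]. exact Hq.
  - destruct H as [(-> & -> & ->)|[H|H]]; [exact Hq| |]; apply in_app_iff; eauto.
Qed.

Lemma subtree_ecarets T : forall x y s a b q, subtree_at T x y s a b ->
  In q (tecarets s a b) -> In q (tecarets T x y).
Proof.
  induction T as [|l IHl r IHr]; intros x y s a b q H Hq.
  - destruct H as [(-> & -> & ->)|[]]. exact Hq.
  - destruct H as [(-> & -> & ->)|[H|H]]; [exact Hq| |]; apply tecarets_node; eauto.
Qed.

(** Descending from the root, the first disagreement is a node that is a leaf of one tree and
    carries a nontrivial subtree [s] of the other. *)
Lemma tree_difference T1 : forall T2 x y, T1 <> T2 -> exists a b s, s <> Leaf /\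
  ((In (a, b) (tleaves T1 x y) /\ subtree_at T2 x y s a b) \/
   (In (a, b) (tleaves T2 x y) /\ subtree_at T1 x y s a b)).
Proof.
  induction T1 as [|l IHl r IHr]; intros T2 x y H.
  - exists x, y, T2. split; [congruence|]. left. split; [simpl; auto|].
    destruct T2; simpl; auto.
  - destruct T2 as [|l2 r2].
    + exists x, y, (Node l r). split; [congruence|]. right. simpl; auto.
    + assert (D : l <> l2 \/ (l = l2 /\ r <> r2)).
      { destruct (Classical_Prop.classic (l = l2)) as [->|h]; [right|left; exact h].
        split; [reflexivity|congruence]. }
      destruct D as [D|[_ D]].
      * destruct (IHl l2 x ((x + y) / 2) D) as (a & b & s & Hs & Hab).
        exists a, b, s. simpl. rewrite !in_app_iff. tauto.
      * destruct (IHr r2 ((x + y) / 2) y D) as (a & b & s & Hs & Hab).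
        exists a, b, s. simpl. rewrite !in_app_iff. tauto.
Qed.

(** Two trees over the same interval halve it in the same way, so a node of one either lies inside a
    leaf of the other or is a node of it. *)
Lemma leaf_vs_tree T : forall T' x y a b, x < y -> In (a, b) (tleaves T x y) ->
  (exists c d, In (c, d) (tleaves T' x y) /\ c <= a /\ b <= d) \/
  (exists s, subtree_at T' x y s a b).
Proof.
  induction T as [|l IHl r IHr]; intros T' x y a b Hxy H.
  - destruct H as [H|[]]. injection H; intros; subst. right. exists T'.
    destruct T'; simpl; auto.
  - destruct T' as [|l' r'].
    + left. exists x, y. apply tleaves_bounds in H; [|lra]. simpl. split; auto; lra.
    + simpl in H. apply in_app_iff in H as [H|H].
      * apply (IHl l') in H; [|lra]. destruct H as [(c & d & Hcd & B)|[s Hs]].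
        -- left. exists c, d. simpl. rewrite in_app_iff. auto.
        -- right. exists s. simpl. auto.
      * apply (IHr r') in H; [|lra]. destruct H as [(c & d & Hcd & B)|[s Hs]].
        -- left. exists c, d. simpl. rewrite in_app_iff. auto.
        -- right. exists s. simpl. auto.
Qed.

Lemma tcarets_nonleaf T x y q : In q (tcarets T x y) -> T <> Leaf.
Proof. destruct T; [intros []|discriminate]. Qed.

Lemma tecarets_nonleaf T x y q : In q (tecarets T x y) -> T <> Leaf.
Proof. destruct T; [intros []|discriminate]. Qed.

(** [T'] is [T] with the exposed caret on [[a, b]] collapsed to a leaf. The last clause records the
    only way a caret can become newly exposed: it is the parent of the collapsed one, which is then
    its left or right half. *)
Lemma prune T : forall x y a b, x < y -> In (a, b) (tecarets T x y) -> exists T',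
  tsize T = S (tsize T') /\
  In (a, b) (tleaves T' x y) /\
  (forall c d, In (c, d) (tleaves T' x y) -> (c = a /\ d = b) \/ In (c, d) (tleaves T x y)) /\
  (forall c d, In (c, d) (tcarets T' x y) -> In (c, d) (tcarets T x y)) /\
  (forall c d, In (c, d) (tcarets T x y) -> (c = a /\ d = b) \/ In (c, d) (tcarets T' x y)) /\
  (forall c d, In (c, d) (tecarets T' x y) ->
     In (c, d) (tecarets T x y) \/ (c = a /\ (c + d) / 2 = b) \/ ((c + d) / 2 = a /\ d = b)).
Proof.
  induction T as [|l IHl r IHr]; intros x y a b Hxy H; [destruct H|].
  assert (Hm : x < (x + y) / 2 < y) by lra.
  apply tecarets_node in H as [(-> & -> & H)|[H|H]].
  - injection H; intros; subst. exists Leaf. simpl.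
    repeat split; auto; intros c d; try tauto;
      intros [h|h]; try tauto; injection h; intros; subst; auto.
  - apply IHl in H as (l' & Hs & Hab & Hle & Hc & Hc' & He); [|lra].
    exists (Node l' r). cbn [tsize tleaves tcarets].
    split; [lia|]. split; [apply in_app_iff; auto|].
    split; [intros c d; rewrite !in_app_iff; intros [h|h]; [apply Hle in h|]; tauto|].
    split; [intros c d [h|h]; [left; exact h|right; rewrite in_app_iff in *; destruct h; auto]|].
    split; [intros c d [h|h]; [right; left; exact h|rewrite in_app_iff in h; destruct h as [h|h]]|].
    + apply Hc' in h as [h|h]; [auto|]. right. right. apply in_app_iff; auto.
    + right. right. apply in_app_iff; auto.
    + intros c d h. apply tecarets_node in h as [(-> & -> & h)|[h|h]].
      * right. injection h; intros; subst.
        destruct Hab as [Hab|[]]. injection Hab; intros; subst. auto.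
      * apply He in h as [h|h]; [left; apply tecarets_node; auto|right; exact h].
      * left. apply tecarets_node; auto.
  - apply IHr in H as (r' & Hs & Hab & Hle & Hc & Hc' & He); [|lra].
    exists (Node l r'). cbn [tsize tleaves tcarets].
    split; [lia|]. split; [apply in_app_iff; auto|].
    split; [intros c d; rewrite !in_app_iff; intros [h|h]; [|apply Hle in h]; tauto|].
    split; [intros c d [h|h]; [left; exact h|right; rewrite in_app_iff in *; destruct h; auto]|].
    split; [intros c d [h|h]; [right; left; exact h|rewrite in_app_iff in h; destruct h as [h|h]]|].
    + right. right. apply in_app_iff; auto.
    + apply Hc' in h as [h|h]; [auto|]. right. right. apply in_app_iff; auto.
    + intros c d h. apply tecarets_node in h as [(-> & -> & h)|[h|h]].
      * right. injection h; intros; subst.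
        destruct Hab as [Hab|[]]. injection Hab; intros; subst. auto.
      * left. apply tecarets_node; auto.
      * apply He in h as [h|h]; [left; apply tecarets_node; auto|right; exact h].
Qed.

(** * Forests and uniqueness of the reduced diagram *)

Lemma in_tree_bounds F i a b : in_tree F i a b -> IZR i <= a /\ a < b /\ b <= IZR i + 1.
Proof. apply tleaves_bounds. lra. Qed.

Lemma is_leaf_lt F a b : is_leaf F a b -> a < b.
Proof. intros [i H]. apply in_tree_bounds in H. lra. Qed.

Lemma in_tree_disjoint F i j a b c d : in_tree F i a b -> in_tree F j c d ->
  (i = j /\ a = c /\ b = d) \/ b <= c \/ d <= a.
Proof.
  intros H1 H2. destruct (Z.eq_dec i j) as [<-|n].
  - destruct (tleaves_disjoint (ftree F i) (IZR i) (IZR i + 1) a b c d); auto; lra.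
  - apply in_tree_bounds in H1, H2. pose proof (unit_disjoint i j n). lra.
Qed.

Lemma leaf_disjoint F a b c d : is_leaf F a b -> is_leaf F c d ->
  (a = c /\ b = d) \/ b <= c \/ d <= a.
Proof.
  intros [i H1] [j H2]. destruct (in_tree_disjoint _ _ _ _ _ _ _ H1 H2); tauto.
Qed.

Lemma leaf_overlap F a b c d : is_leaf F a b -> is_leaf F c d -> c < b -> a < d ->
  a = c /\ b = d.
Proof. intros H1 H2 h1 h2. destruct (leaf_disjoint _ _ _ _ _ H1 H2) as [h|h]; auto; lra. Qed.

Lemma leaf_cover_l F t : exists a b, is_leaf F a b /\ a <= t < b.
Proof.
  destruct (unit_cover_l t) as [i Hi].
  destruct (tleaves_cover_l (ftree F i) (IZR i) (IZR i + 1) t Hi) as (a & b & H & Ht).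
  exists a, b. split; [exists i; exact H|exact Ht].
Qed.

Lemma leaf_cover_r F t : exists a b, is_leaf F a b /\ a < t <= b.
Proof.
  destruct (unit_cover_r t) as [i Hi].
  destruct (tleaves_cover_r (ftree F i) (IZR i) (IZR i + 1) t Hi) as (a & b & H & Ht).
  exists a, b. split; [exists i; exact H|exact Ht].
Qed.

Lemma trivial_tree_leaf F i : ftree F i = Leaf -> in_tree F i (IZR i) (IZR i + 1).
Proof. intros H. unfold in_tree. rewrite H. simpl; auto. Qed.

Lemma in_trivial_tree F i a b : ftree F i = Leaf -> in_tree F i a b -> a = IZR i /\ b = IZR i + 1.
Proof.
  unfold in_tree. intros -> [H|[]]. injection H; auto.
Qed.

Lemma in_tree_full F i j : in_tree F i (IZR j) (IZR j + 1) -> i = j /\ ftree F i = Leaf.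
Proof.
  intros H. assert (E : i = j).
  { destruct (Z.eq_dec i j) as [|n]; auto. apply in_tree_bounds in H.
    pose proof (unit_disjoint i j n). lra. }
  subst. split; [reflexivity|]. apply tleaves_full in H; auto; lra.
Qed.

Lemma leaf_at_start F a b : is_leaf F a b -> exists c, is_leaf F c a.
Proof.
  intros H. destruct (leaf_cover_r F a) as (a' & b' & H' & h).
  destruct (leaf_disjoint _ _ _ _ _ H H') as [E|E]; [lra|].
  pose proof (is_leaf_lt _ _ _ H). assert (b' = a) by lra. subst. eauto.
Qed.

Lemma ftree_outside F i : (i < flo F \/ flo F + Z.of_nat (length (ftrees F)) <= i)%Z ->
  ftree F i = Leaf.
Proof.
  intros H. unfold ftree. destruct (Z.ltb_spec i (flo F)); [reflexivity|].
  apply nth_overflow. lia.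
Qed.

(** * Changing the list that represents a forest *)

Definition list_carets (ts : list tree) : nat :=
  fold_right (fun t n => (tsize t + n)%nat) 0%nat ts.

Lemma list_carets_app l1 l2 : list_carets (l1 ++ l2) = (list_carets l1 + list_carets l2)%nat.
Proof. induction l1; simpl; lia. Qed.

Lemma list_carets_repeat k : list_carets (repeat Leaf k) = 0%nat.
Proof. induction k; simpl; lia. Qed.

(** The lists may have different lengths: with default [Leaf], any surplus entries are trivial
    trees, which have no carets. *)
Lemma list_carets_nth_ext l1 : forall l2, (forall k, nth k l1 Leaf = nth k l2 Leaf) ->
  list_carets l1 = list_carets l2.
Proof.
  induction l1 as [|t l1 IH]; intros l2 H.
  - simpl. induction l2 as [|t l2 IH]; [reflexivity|].
    simpl. rewrite <- IH.
    + specialize (H 0%nat). simpl in H. subst. reflexivity.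
    + intros k. specialize (H (S k)). simpl in H. rewrite <- H. destruct k; reflexivity.
  - destruct l2 as [|t2 l2].
    + simpl. rewrite (IH []).
      * specialize (H 0%nat). simpl in H. subst. reflexivity.
      * intros k. specialize (H (S k)). simpl in H. rewrite H. destruct k; reflexivity.
    + simpl. rewrite (IH l2).
      * specialize (H 0%nat). simpl in H. subst. reflexivity.
      * intros k. exact (H (S k)).
Qed.

Lemma nth_repeat_app k l n :
  nth n (repeat Leaf k ++ l) Leaf = if (n <? k)%nat then Leaf else nth (n - k) l Leaf.
Proof.
  destruct (Nat.ltb_spec n k).
  - rewrite app_nth1 by (rewrite repeat_length; lia). apply nth_repeat.
  - rewrite app_nth2 by (rewrite repeat_length; lia). rewrite repeat_length. reflexivity.
Qed.

Lemma ftree_pad_left F k i :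
  ftree {| flo := flo F - Z.of_nat k; ftrees := repeat Leaf k ++ ftrees F |} i = ftree F i.
Proof.
  unfold ftree; simpl. rewrite nth_repeat_app.
  destruct (Z.ltb_spec i (flo F - Z.of_nat k)), (Z.ltb_spec i (flo F)),
    (Nat.ltb_spec (Z.to_nat (i - (flo F - Z.of_nat k))) k); try lia; try reflexivity.
  f_equal. lia.
Qed.

Lemma nth_app_repeat n l k : nth n (l ++ repeat Leaf k) Leaf = nth n l Leaf.
Proof.
  destruct (Nat.lt_ge_cases n (length l)).
  - apply app_nth1; lia.
  - rewrite app_nth2, nth_repeat, nth_overflow; auto.
Qed.

(** A forest has many representations as an offset and a list. Padding both lists with trivial trees
    down to the common offset [lo] makes them comparable entry by entry. *)
Lemma ncarets_ext F G : (forall i, ftree F i = ftree G i) -> ncarets F = ncarets G.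
Proof.
  set (lo := Z.min (flo F) (flo G)).
  set (kF := Z.to_nat (flo F - lo)). set (kG := Z.to_nat (flo G - lo)).
  intros H.
  assert (E : list_carets (repeat Leaf kF ++ ftrees F) = list_carets (repeat Leaf kG ++ ftrees G)).
  { apply list_carets_nth_ext. intros n.
    pose proof (ftree_pad_left F kF (lo + Z.of_nat n)) as HF.
    pose proof (ftree_pad_left G kG (lo + Z.of_nat n)) as HG.
    rewrite <- H, <- HF in HG. unfold ftree in HG; simpl in HG.
    replace (flo F - Z.of_nat kF)%Z with lo in HG by lia.
    replace (flo G - Z.of_nat kG)%Z with lo in HG by lia.
    destruct (Z.ltb_spec (lo + Z.of_nat n) lo); [lia|].
    replace (Z.to_nat (lo + Z.of_nat n - lo)) with n in HG by lia. congruence. }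
  rewrite !list_carets_app, !list_carets_repeat in E. exact E.
Qed.

Lemma firstn_nth_skipn (d : tree) l : forall n, (n < length l)%nat ->
  firstn n l ++ nth n l d :: skipn (S n) l = l.
Proof.
  induction l as [|t l IH]; simpl; intros n H; [lia|].
  destruct n; [reflexivity|]. simpl. f_equal. apply IH. lia.
Qed.

Lemma forest_around F i : exists A B,
  (forall j, ftree F j =
     ftree {| flo := i - Z.of_nat (length A); ftrees := A ++ ftree F i :: B |} j).
Proof.
  set (k := Z.to_nat (flo F - i)).
  (* Padding on the left reaches down to [i] and padding on the right reaches up to [i], so that
     position [i] is listed explicitly wherever it lay. *)
  set (L := repeat Leaf k ++ ftrees F ++ repeat Leaf (S (Z.to_nat (i - flo F)))).
  set (lo := (flo F - Z.of_nat k)%Z).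
  assert (HL : forall j, ftree F j = ftree {| flo := lo; ftrees := L |} j).
  { intros j. unfold lo, L.
    pose proof (ftree_pad_left
      {| flo := flo F; ftrees := ftrees F ++ repeat Leaf (S (Z.to_nat (i - flo F))) |} k j) as E.
    cbn [flo ftrees] in E. rewrite E.
    unfold ftree; cbn [flo ftrees]. rewrite nth_app_repeat. reflexivity. }
  set (n := Z.to_nat (i - lo)).
  assert (Hn : (n < length L)%nat).
  { unfold L. rewrite !length_app, !repeat_length. unfold n, lo. lia. }
  exists (firstn n L), (skipn (S n) L). intros j.
  assert (E : ftree F i = nth n L Leaf).
  { rewrite HL. unfold ftree; simpl. destruct (Z.ltb_spec i lo); [lia|reflexivity]. }
  rewrite E. rewrite HL. rewrite length_firstn, Nat.min_l by lia.
  rewrite firstn_nth_skipn by exact Hn.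
  replace (i - Z.of_nat n)%Z with lo by lia. reflexivity.
Qed.

(** The one surgery behind all changes of forests: two trees for [ts] split a root caret, one tree
    prunes, and the empty list deletes a trivial tree. Trees right of [i] are renumbered by
    [length ts - 1]; the caret count is stated additively to avoid truncated subtraction. *)
Lemma forest_replace F i ts : exists F',
  (forall j, (j < i)%Z -> ftree F' j = ftree F j) /\
  (forall k, (k < length ts)%nat -> ftree F' (i + Z.of_nat k) = nth k ts Leaf) /\
  (forall j, (i < j)%Z -> ftree F' (j + Z.of_nat (length ts) - 1) = ftree F j) /\
  (ncarets F' + tsize (ftree F i) = ncarets F + list_carets ts)%nat.
Proof.
  destruct (forest_around F i) as (A & B & H).
  set (lo := (i - Z.of_nat (length A))%Z) in *.
  exists {| flo := lo; ftrees := A ++ ts ++ B |}.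
  repeat split.
  - intros j Hj. rewrite (H j). unfold ftree; simpl.
    destruct (Z.ltb_spec j lo); [reflexivity|].
    rewrite !app_nth1 by lia. reflexivity.
  - intros k Hk. unfold ftree; simpl.
    destruct (Z.ltb_spec (i + Z.of_nat k) lo); [lia|].
    rewrite app_nth2 by lia. rewrite app_nth1 by lia. f_equal. lia.
  - intros j Hj. rewrite (H j). unfold ftree; simpl.
    destruct (Z.ltb_spec (j + Z.of_nat (length ts) - 1) lo); [lia|].
    destruct (Z.ltb_spec j lo); [lia|].
    rewrite !(app_nth2 A) by lia. rewrite app_nth2 by lia.
    replace (Z.to_nat (j - lo) - length A)%nat with (S (Z.to_nat (j - i) - 1)) by lia.
    simpl. f_equal. lia.
  - rewrite (ncarets_ext _ _ H). unfold ncarets; simpl.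
    fold (list_carets (A ++ ts ++ B)). fold (list_carets (A ++ ftree F i :: B)).
    rewrite !list_carets_app. simpl. fold (list_carets B). lia.
Qed.

(** * Functions with a forest diagram are increasing bijections *)

Definition homeo (f : R -> R) : Prop :=
  (forall s t, s < t -> f s < f t) /\ (forall y, exists t, f t = y).

Lemma homeo_lt f s t : homeo f -> s < t <-> f s < f t.
Proof.
  intros [H _]. split; [apply H|]. intros h.
  destruct (Rtotal_order s t) as [|[->|g]]; auto; [lra|]. apply H in g. lra.
Qed.

Lemma homeo_le f s t : homeo f -> s <= t <-> f s <= f t.
Proof. intros H. pose proof (homeo_lt f t s H). split; intros; apply Rnot_lt_le; intro; intuition lra. Qed.

Lemma homeo_inj f s t : homeo f -> f s = f t -> s = t.
Proof.
  intros H E. apply Rle_antisym; apply (homeo_le f); auto; lra.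
Qed.

Lemma homeo_comp h f : homeo h -> homeo f -> homeo (fun t => h (f t)).
Proof.
  intros [H1 H2] [H3 H4]. split; [auto|]. intros y.
  destruct (H2 y) as [s <-]. destruct (H4 s) as [t <-]. eauto.
Qed.

Lemma tree_increasing f T : forall x y, x < y ->
  (forall a b, In (a, b) (tleaves T x y) -> forall s t, a <= s -> s < t -> t <= b -> f s < f t) ->
  forall s t, x <= s -> s < t -> t <= y -> f s < f t.
Proof.
  induction T as [|l IHl r IHr]; intros x y Hxy H s t hs hst ht.
  - apply (H x y); simpl; auto.
  - assert (H1 : forall s t, x <= s -> s < t -> t <= (x + y) / 2 -> f s < f t).
    { apply IHl; [lra|]. intros a b Hab. apply H. simpl. apply in_app_iff; auto. }
    assert (H2 : forall s t, (x + y) / 2 <= s -> s < t -> t <= y -> f s < f t).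
    { apply IHr; [lra|]. intros a b Hab. apply H. simpl. apply in_app_iff; auto. }
    destruct (Rle_lt_dec t ((x + y) / 2)); [apply H1; lra|].
    destruct (Rle_lt_dec ((x + y) / 2) s); [apply H2; lra|].
    apply Rlt_trans with (f ((x + y) / 2)); [apply H1|apply H2]; lra.
Qed.

Lemma tree_onto f T : forall x y, x < y ->
  (forall a b, In (a, b) (tleaves T x y) ->
     forall z, f a <= z <= f b -> exists t, f t = z) ->
  forall z, f x <= z <= f y -> exists t, f t = z.
Proof.
  induction T as [|l IHl r IHr]; intros x y Hxy H z hz.
  - apply (H x y); simpl; auto.
  - destruct (Rle_lt_dec z (f ((x + y) / 2))).
    + apply (IHl x ((x + y) / 2)); try lra. intros a b Hab. apply H. simpl. apply in_app_iff; auto.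
    + apply (IHr ((x + y) / 2) y); try lra. intros a b Hab. apply H. simpl. apply in_app_iff; auto.
Qed.

Lemma diagram_increasing D f : diagram_of D f -> forall s t, s < t -> f s < f t.
Proof.
  intros HD.
  assert (U : forall i s t, IZR i <= s -> s < t -> t <= IZR i + 1 -> f s < f t).
  { intros i. apply (tree_increasing f (ftree (dbot D) i)); [lra|].
    intros a b Hab s t hs hst ht.
    assert (Hl : is_leaf (dbot D) a b) by (exists i; exact Hab).
    pose proof (is_leaf_lt _ _ _ Hl) as hab.
    destruct (HD _ _ Hl) as [Hl' HL]. pose proof (is_leaf_lt _ _ _ Hl') as hf.
    rewrite (HL s), (HL t) by lra.
    assert (0 < (f b - f a) / (b - a)) by (apply Rdiv_lt_0_compat; lra).
    assert ((t - s) * ((f b - f a) / (b - a)) > 0) by (apply Rmult_lt_0_compat; lra).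
    unfold Rdiv in *. nra. }
  (* Monotonicity on unit intervals is chained through the integers in between, over [S n]
     consecutive units. *)
  assert (V : forall n i s t, IZR i <= s -> s < t -> t <= IZR i + INR (S n) -> f s < f t).
  { induction n as [|n IH]; intros i s t hs hst ht.
    - apply (U i); simpl in ht; lra.
    - rewrite S_INR in ht.
      destruct (Rle_lt_dec t (IZR i + 1)) as [h|h]; [apply (U i); lra|].
      destruct (Rle_lt_dec (IZR i + 1) s) as [g|g].
      + apply (IH (i + 1)%Z); rewrite ?plus_IZR; lra.
      + apply Rlt_trans with (f (IZR i + 1)); [apply (U i); lra|].
        apply (IH (i + 1)%Z); rewrite ?plus_IZR; lra. }
  intros s t hst. destruct (unit_cover_l s) as [i Hi].
  destruct (INR_unbounded (t - IZR i)) as [n Hn].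
  apply (V n i); try lra. rewrite S_INR. lra.
Qed.

Lemma diagram_onto_between D f : diagram_of D f -> forall n i z,
  f (IZR i) <= z <= f (IZR i + INR n) -> exists t, f t = z.
Proof.
  intros HD.
  assert (U : forall i z, f (IZR i) <= z <= f (IZR i + 1) -> exists t, f t = z).
  { intros i. apply (tree_onto f (ftree (dbot D) i)); [lra|].
    intros a b Hab z hz.
    assert (Hl : is_leaf (dbot D) a b) by (exists i; exact Hab).
    pose proof (is_leaf_lt _ _ _ Hl) as hab.
    destruct (HD _ _ Hl) as [Hl' HL]. pose proof (is_leaf_lt _ _ _ Hl') as hf.
    exists (a + (z - f a) * ((b - a) / (f b - f a))).
    assert (0 < (b - a) / (f b - f a)) by (apply Rdiv_lt_0_compat; lra).
    assert (E : (f b - f a) * ((b - a) / (f b - f a)) = b - a) by (field; lra).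
    rewrite HL; [field; lra|]. split; [nra|]. nra. }
  induction n as [|n IH]; intros i z hz.
  - simpl in hz. rewrite Rplus_0_r in hz. exists (IZR i). lra.
  - rewrite S_INR in hz. destruct (Rle_lt_dec z (f (IZR i + 1))); [apply (U i); lra|].
    apply (IH (i + 1)%Z). rewrite plus_IZR.
    replace (IZR i + 1 + INR n) with (IZR i + (INR n + 1)) by ring. lra.
Qed.

Lemma list_bound (l : list R) : exists M, forall b, In b l -> - M <= b <= M.
Proof.
  induction l as [|x l [M IH]].
  - exists 0. intros b [].
  - exists (Rabs x + Rabs M). intros b [<-|H].
    + pose proof (Rle_abs x). pose proof (Rle_abs (- x)). rewrite Rabs_Ropp in *.
      pose proof (Rabs_pos M). lra.
    + apply IH in H. pose proof (Rle_abs M). pose proof (Rabs_pos x). lra.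
Qed.

(** The diagram gives monotonicity and all values between the images of two integers. That [f] is
    unbounded in both directions is read off from the translations at the two ends in [inF]. *)
Lemma diagram_homeo D f : inF f -> diagram_of D f -> homeo f.
Proof.
  intros (bs & m & n & _ & _ & _ & Hm & Hn) HD.
  split; [exact (diagram_increasing D f HD)|]. intros z.
  destruct (list_bound bs) as [M HM].
  (* The integers [i] and [i + k] lie beyond all breakpoints and are far enough out that their
     images [i - m] and [i + k - n] enclose [z]. *)
  destruct (unit_cover_l (Rmin (- M) (z + IZR m))) as [i Hi].
  destruct (INR_unbounded (Rmax M (z + IZR n) - IZR i)) as [k Hk].
  pose proof (Rmin_l (- M) (z + IZR m)). pose proof (Rmin_r (- M) (z + IZR m)).
  pose proof (Rmax_l M (z + IZR n)). pose proof (Rmax_r M (z + IZR n)).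
  apply (diagram_onto_between D f HD k i). rewrite Hm, Hn.
  - lra.
  - intros b Hb. apply HM in Hb. lra.
  - intros b Hb. apply HM in Hb. lra.
Qed.

(** [diagram_of] only sends bottom leaves to top leaves; this is the other half of the matching. The
    bottom leaf around the preimage of the midpoint of [[c, d]] has an image leaf overlapping
    [[c, d]], hence equal to it. *)
Lemma top_leaf_preimage D f c d : diagram_of D f -> homeo f -> is_leaf (dtop D) c d ->
  exists a b, is_leaf (dbot D) a b /\ f a = c /\ f b = d.
Proof.
  intros HD Hf Hl. pose proof (is_leaf_lt _ _ _ Hl).
  destruct (proj2 Hf ((c + d) / 2)) as [t Ht].
  destruct (leaf_cover_l (dbot D) t) as (a & b & Hab & h).
  exists a, b. split; [exact Hab|].
  destruct (HD _ _ Hab) as [Hl' _].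
  pose proof (proj1 (homeo_le f a t Hf)). pose proof (proj1 (homeo_lt f t b Hf)).
  apply (leaf_overlap (dtop D)); auto; lra.
Qed.

Lemma reduced_no_subtree D1 D2 f i a b s : homeo f -> diagram_of D1 f ->
  reduced_diagram_of D2 f -> is_leaf (dbot D1) a b ->
  subtree_at (ftree (dbot D2) i) (IZR i) (IZR i + 1) s a b -> s <> Leaf -> False.
Proof.
  intros Hf HD1 [HD2 HR] Hab Hs Hnl.
  pose proof (is_leaf_lt _ _ _ Hab) as hab.
  destruct (HD1 _ _ Hab) as [[k Hk] HL].
  pose proof (in_tree_bounds _ _ _ _ Hk) as hfab.
  set (L := fun t => f a + (t - a) * (f b - f a) / (b - a)).
  change (forall t, a <= t <= b -> f t = L t) in HL.
  assert (LM : midpoint_affine L) by (intros ? ?; unfold L; field; lra).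
  assert (La : L a = f a) by (unfold L; field; lra).
  assert (Lb : L b = f b) by (unfold L; field; lra).
  (* On [[a, b]] the function is the affine map [L], so the leaves of [s] are carried to top leaves
     of [D2] that form a copy of [s] over [[f a, f b]]. *)
  assert (HT : forall p q, In (p, q) (tleaves s (f a) (f b)) -> is_leaf (dtop D2) p q).
  { intros p q H. rewrite <- La, <- Lb, tleaves_affine in H by exact LM.
    apply in_map_iff in H as ([p0 q0] & E & H). injection E; simpl; intros; subst p q.
    pose proof (tleaves_bounds _ _ _ _ _ hab H).
    rewrite <- !HL by lra. apply HD2. exists i. eapply subtree_leaves; eauto. }
  (* [[f a, f b]] is a leaf of [D1], hence a dyadic node. In the top forest of [D2] it cannot lie
     inside a leaf, as the nontrivial copy of [s] subdivides it; so it is a node there, and its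
     subtree has the leaves of [s]. *)
  destruct (leaf_vs_tree (ftree (dtop D1) k) (ftree (dtop D2) k) (IZR k) (IZR k + 1) (f a) (f b))
    as [(c & d & Hcd & h1 & h2)|[s' Hs']]; [lra|exact Hk| |].
  - destruct (tleaves_cover_l s (f a) (f b) (f a)) as (p & q & Hpq & h); [lra|].
    assert (Hc : is_leaf (dtop D2) c d) by (exists k; exact Hcd).
    pose proof (tleaves_bounds _ _ _ _ _ (proj1 (proj2 hfab)) Hpq).
    destruct (leaf_overlap _ _ _ _ _ (HT _ _ Hpq) Hc); [lra|lra|].
    apply Hnl, (tleaves_full s (f a) (f b)); [lra|].
    replace (f a) with p at 1 by lra. replace (f b) with q at 1 by lra. exact Hpq.
  - assert (Es : s = s').
    { apply (tleaves_incl_eq s s' (f a) (f b)); [lra|]. intros [p q] Hpq.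
      pose proof (tleaves_bounds _ _ _ _ _ (proj1 (proj2 hfab)) Hpq).
      destruct (tleaves_cover_l s' (f a) (f b) p) as (p' & q' & Hpq' & h); [lra|].
      assert (Hl' : is_leaf (dtop D2) p' q').
      { exists k. unfold in_tree. eapply subtree_leaves; eauto. }
      destruct (leaf_overlap _ _ _ _ _ (HT _ _ Hpq) Hl'); [lra|lra|]. subst; exact Hpq'. }
    subst s'.
    destruct (tecarets_exists s a b Hnl) as (p & q & Hpq).
    destruct (tecarets_halves _ _ _ _ _ Hpq) as [B1 B2].
    apply tleaves_bounds in B1; [|lra]. apply tleaves_bounds in B2; [|lra].
    apply HR. exists p, q, (L p), (L q). repeat split.
    + exists i. eapply subtree_ecarets; eauto.
    + exists k. eapply subtree_ecarets; eauto. rewrite <- La, <- Lb, tecarets_affine by exact LM.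
      exact (in_map (pair_map L) _ _ Hpq).
    + apply HL; lra.
    + rewrite <- LM. apply HL; lra.
    + apply HL; lra.
Qed.

Lemma reduced_bot_unique D1 D2 f : homeo f ->
  reduced_diagram_of D1 f -> reduced_diagram_of D2 f ->
  forall i, ftree (dbot D1) i = ftree (dbot D2) i.
Proof.
  intros Hf H1 H2 i. apply NNPP. intros H.
  destruct (tree_difference _ _ (IZR i) (IZR i + 1) H) as (a & b & s & Hs & [[Hl Hc]|[Hl Hc]]).
  - apply (reduced_no_subtree D1 D2 f i a b s); auto; [apply H1|exists i; exact Hl].
  - apply (reduced_no_subtree D2 D1 f i a b s); auto; [apply H2|exists i; exact Hl].
Qed.

Lemma is_leaf_ext F G : (forall i, ftree F i = ftree G i) ->
  forall a b, is_leaf F a b -> is_leaf G a b.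
Proof. intros E a b [i H]. exists i. unfold in_tree in *. rewrite <- E. exact H. Qed.

(** The top leaves are the images of the bottom leaves, which are already known to agree. *)
Lemma reduced_top_unique D1 D2 f : homeo f ->
  reduced_diagram_of D1 f -> reduced_diagram_of D2 f ->
  forall i, ftree (dtop D1) i = ftree (dtop D2) i.
Proof.
  intros Hf H1 H2 i. apply (tleaves_incl_eq _ _ (IZR i) (IZR i + 1)); [lra|].
  intros [c d] Hcd.
  destruct (top_leaf_preimage D1 f c d (proj1 H1) Hf) as (a & b & Hab & <- & <-);
    [exists i; exact Hcd|].
  assert (Hab' : is_leaf (dbot D2) a b).
  { apply (is_leaf_ext (dbot D1)); [apply (reduced_bot_unique D1 D2 f)|]; auto. }
  destruct (proj1 H2 _ _ Hab') as [[k Hk] _].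
  assert (k = i); [|subst; exact Hk].
  destruct (Z.eq_dec k i) as [|n]; auto. apply unit_disjoint in n.
  apply in_tree_bounds in Hk. apply tleaves_bounds in Hcd; lra.
Qed.


(** * Comparing lengths *)

Lemma dec_true P : P -> dec P = true.
Proof. unfold dec. destruct (ClassicalDescription.excluded_middle_informative P); [reflexivity|contradiction]. Qed.

Lemma dec_false P : ~ P -> dec P = false.
Proof. unfold dec. destruct (ClassicalDescription.excluded_middle_informative P); [contradiction|reflexivity]. Qed.

Lemma dec_iff P : dec P = true <-> P.
Proof. unfold dec. destruct (ClassicalDescription.excluded_middle_informative P); split; auto; discriminate. Qed.

Lemma dec_ext P Q : (P <-> Q) -> dec P = dec Q.
Proof.
  intros H. destruct (classic P) as [p|p].
  - rewrite !dec_true; tauto.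
  - rewrite !dec_false; tauto.
Qed.

(** * Comparing sums of weights over different supports *)

Definition wsum (w : R -> nat) (l : list R) : nat :=
  fold_right (fun p s => (w p + s)%nat) 0%nat l.

Lemma wsum_mid w l1 p l2 : wsum w (l1 ++ p :: l2) = (w p + wsum w (l1 ++ l2))%nat.
Proof. induction l1; simpl in *; lia. Qed.

Lemma incl_drop_mid (p : R) l l1 l2 : ~ In p l -> incl l (l1 ++ p :: l2) -> incl l (l1 ++ l2).
Proof.
  intros Hp H q Hq. pose proof (H q Hq) as h. rewrite in_app_iff in *. simpl in h.
  destruct h as [h|[<-|h]]; tauto.
Qed.

Lemma wsum_le w w' l' : forall l, NoDup l' -> incl l' l ->
  (forall p, In p l' -> (w' p <= w p)%nat) -> (wsum w' l' <= wsum w l)%nat.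
Proof.
  induction l' as [|p l' IH]; intros l Hn Hi Hw; [simpl; lia|].
  inversion Hn; subst.
  destruct (in_split p l) as (l1 & l2 & ->); [apply Hi; simpl; auto|].
  rewrite wsum_mid. simpl. apply Nat.add_le_mono; [apply Hw; simpl; auto|].
  apply IH; auto.
  - apply (incl_drop_mid p); auto. intros q Hq. apply Hi. simpl; auto.
  - intros q Hq. apply Hw. simpl; auto.
Qed.

(** The point [p0] may lose weight or drop out of the list altogether; positivity of [w p0] makes
    the second case strict as well. *)
Lemma wsum_lt w w' l' l p0 : NoDup l' -> incl l' l ->
  (forall p, In p l' -> (w' p <= w p)%nat) ->
  In p0 l -> (0 < w p0)%nat -> (In p0 l' -> (w' p0 < w p0)%nat) ->
  (wsum w' l' < wsum w l)%nat.
Proof.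
  intros Hn Hi Hw Hp Hp0 Hlt.
  destruct (in_split p0 l Hp) as (l1 & l2 & ->). rewrite wsum_mid.
  destruct (classic (In p0 l')) as [Hin|Hnin].
  - specialize (Hlt Hin). destruct (in_split p0 l' Hin) as (l1' & l2' & ->). rewrite wsum_mid.
    apply NoDup_remove in Hn as [Hn Hn'].
    assert (wsum w' (l1' ++ l2') <= wsum w (l1 ++ l2))%nat; [|lia].
    apply wsum_le; auto.
    + apply (incl_drop_mid p0); auto. intros q Hq. apply Hi.
      rewrite in_app_iff in *. simpl. tauto.
    + intros q Hq. apply Hw. rewrite in_app_iff in *. simpl. tauto.
  - assert (wsum w' l' <= wsum w (l1 ++ l2))%nat; [|lia].
    apply wsum_le; auto. apply (incl_drop_mid p0); auto.
Qed.

(** * Finiteness of the support and well-definedness of the length *)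

Lemma required_bounded_forest F : exists M, forall i a b, in_tree F i a b ->
  ftree F i <> Leaf \/ i = 0%Z -> - M <= a /\ b <= M.
Proof.
  exists (IZR (Z.abs (flo F) + Z.of_nat (length (ftrees F)) + 1)). intros i a b H Hi.
  assert (B : (- (Z.abs (flo F) + Z.of_nat (length (ftrees F)) + 1) <= i
     /\ i + 1 <= Z.abs (flo F) + Z.of_nat (length (ftrees F)) + 1)%Z).
  { destruct (classic (i < flo F \/ flo F + Z.of_nat (length (ftrees F)) <= i)%Z) as [h|h].
    - destruct Hi as [Hi|Hi]; [exfalso; apply Hi; apply ftree_outside; exact h|lia].
    - lia. }
  apply in_tree_bounds in H. destruct B as [B1 B2]. apply IZR_le in B1, B2.
  rewrite opp_IZR in B1. rewrite plus_IZR in B2. lra.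
Qed.

Lemma required_bounded D f : homeo f -> exists M, forall a b, required_col D f a b ->
  - M <= a /\ b <= M.
Proof.
  intros Hf.
  destruct (required_bounded_forest (dbot D)) as [M1 H1].
  destruct (required_bounded_forest (dtop D)) as [M2 H2].
  destruct (proj2 Hf (- M2)) as [s Hs]. destruct (proj2 Hf M2) as [t Ht].
  exists (Rmax M1 (Rmax (- s) t)).
  pose proof (Rmax_l M1 (Rmax (- s) t)). pose proof (Rmax_r M1 (Rmax (- s) t)).
  pose proof (Rmax_l (- s) t). pose proof (Rmax_r (- s) t).
  intros a b [[i [Hi Hi']]|[i [Hi Hi']]].
  - destruct (H1 _ _ _ Hi Hi'). lra.
  - destruct (H2 _ _ _ Hi Hi') as [h1 h2]. rewrite <- Hs in h1. rewrite <- Ht in h2.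
    apply (homeo_le f) in h1, h2; auto. lra.
Qed.

(** The trees with indices from [-K-1] to [K]. The additional one on the left is needed because the
    endpoint [-K] is a right end in the tree with index [-K-1]. *)
Definition window_ends (F : forest) (K : nat) : list R :=
  flat_map (fun k => let i := (Z.of_nat k - Z.of_nat K - 1)%Z in
    map snd (tleaves (ftree F i) (IZR i) (IZR i + 1))) (seq 0 (2 * K + 2)).

Lemma in_window_ends F K a p : is_leaf F a p -> - INR K <= p <= INR K ->
  In p (window_ends F K).
Proof.
  intros [i Hi] Hp. pose proof (in_tree_bounds _ _ _ _ Hi) as B.
  rewrite INR_IZR_INZ in Hp.
  assert (B1 : (- Z.of_nat K - 1 <= i)%Z).
  { apply le_IZR. rewrite minus_IZR, opp_IZR. lra. }
  assert (B2 : (i < Z.of_nat K)%Z).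
  { apply lt_IZR. lra. }
  apply in_flat_map. exists (Z.to_nat (i + Z.of_nat K + 1)). split.
  - apply in_seq. lia.
  - cbv zeta. replace (Z.of_nat (Z.to_nat (i + Z.of_nat K + 1)) - Z.of_nat K - 1)%Z with i by lia.
    exact (in_map snd _ _ Hi).
Qed.

Lemma diag_length_exists D f : homeo f -> exists n, diag_length D f n.
Proof.
  intros Hf. destruct (required_bounded D f Hf) as [M HM].
  destruct (INR_unbounded M) as [K HK].
  set (ps := filter (fun p => dec (support_space D f p))
    (nodup Req_dec_T (window_ends (dbot D) K))).
  exists (wsum (space_weight D f) ps + ncarets (dbot D) + ncarets (dtop D))%nat, ps.
  split; [apply NoDup_filter, NoDup_nodup|]. split; [|reflexivity].
  intros p. unfold ps. rewrite filter_In, dec_iff, nodup_In. split; [tauto|].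
  intros Hs. split; [|exact Hs]. destruct Hs as ([a Ha] & (a1 & b1 & h1 & g1) & (a2 & b2 & h2 & g2)).
  apply HM in h1, h2. apply (in_window_ends _ _ a); auto. lra.
Qed.

(** The forests agree tree by tree but not necessarily as records, and the two lists of spaces may
    be ordered differently. The sums are therefore compared by inclusion in both directions. *)
Lemma diag_length_unique D1 D2 f n1 n2 : homeo f ->
  reduced_diagram_of D1 f -> reduced_diagram_of D2 f ->
  diag_length D1 f n1 -> diag_length D2 f n2 -> n1 = n2.
Proof.
  intros Hf H1 H2 (l1 & N1 & S1 & ->) (l2 & N2 & S2 & ->).
  pose proof (reduced_bot_unique D1 D2 f Hf H1 H2) as Eb.
  pose proof (reduced_top_unique D1 D2 f Hf H1 H2) as Et.
  rewrite (ncarets_ext _ _ Eb), (ncarets_ext _ _ Et).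
  apply functional_extensionality in Eb, Et.
  assert (ES : forall p, support_space D1 f p <-> support_space D2 f p).
  { intros p. unfold support_space, required_col, is_leaf, in_tree. rewrite Eb, Et. tauto. }
  assert (EW : forall p, space_weight D1 f p = space_weight D2 f p).
  { intros p. unfold space_weight, label_of, left_of_caret, is_caret. rewrite Eb, Et. reflexivity. }
  change (wsum (space_weight D1 f) l1 + ncarets (dbot D2) + ncarets (dtop D2) =
    wsum (space_weight D2 f) l2 + ncarets (dbot D2) + ncarets (dtop D2))%nat.
  do 2 f_equal. apply Nat.le_antisymm; apply wsum_le; auto.
  - intros p Hp. apply S2, ES, S1, Hp.
  - intros p _. rewrite EW. lia.
  - intros p Hp. apply S1, ES, S2, Hp.
  - intros p _. rewrite EW. lia.
Qed.

Lemma ell_eq D f n : homeo f -> reduced_diagram_of D f -> diag_length D f n -> ell f = n.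
Proof.
  intros Hf HD Hn.
  assert (H : exists D', reduced_diagram_of D' f /\ diag_length D' f (ell f)).
  { unfold ell. apply epsilon_spec. exists n, D. auto. }
  destruct H as (D' & H1 & H2). exact (diag_length_unique D' D f _ _ Hf H1 HD H2 Hn).
Qed.

(** The criterion behind every case: no space appears or gains weight, no carets are added overall,
    and either a caret is lost or one space of positive weight gets lighter or leaves the
    support. *)
Lemma ell_decreases D D' f g : homeo f -> homeo g ->
  reduced_diagram_of D f -> reduced_diagram_of D' g ->
  (forall p, support_space D' g p -> support_space D f p /\
     (space_weight D' g p <= space_weight D f p)%nat) ->
  (ncarets (dbot D') + ncarets (dtop D') <= ncarets (dbot D) + ncarets (dtop D))%nat ->
  (ncarets (dbot D') + ncarets (dtop D') < ncarets (dbot D) + ncarets (dtop D))%nat \/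
  (exists p0, support_space D f p0 /\ (0 < space_weight D f p0)%nat /\
     (support_space D' g p0 -> (space_weight D' g p0 < space_weight D f p0)%nat)) ->
  (ell g < ell f)%nat.
Proof.
  intros Hf Hg HD HD' Hs Hc Hlt.
  destruct (diag_length_exists D f Hf) as [n Hn].
  destruct (diag_length_exists D' g Hg) as [n' Hn'].
  rewrite (ell_eq D f n Hf HD Hn), (ell_eq D' g n' Hg HD' Hn').
  destruct Hn as (l & N & S & ->), Hn' as (l' & N' & S' & ->).
  change (wsum (space_weight D' g) l' + ncarets (dbot D') + ncarets (dtop D') <
    wsum (space_weight D f) l + ncarets (dbot D) + ncarets (dtop D))%nat.
  assert (I : incl l' l) by (intros p Hp; apply S, Hs, S', Hp).
  assert (W : forall p, In p l' -> (space_weight D' g p <= space_weight D f p)%nat)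
    by (intros p Hp; apply Hs, S', Hp).
  destruct Hlt as [Hlt|(p0 & h1 & h2 & h3)].
  - pose proof (wsum_le _ _ _ l N' I W). lia.
  - assert (wsum (space_weight D' g) l' < wsum (space_weight D f) l)%nat; [|lia].
    apply (wsum_lt _ _ _ _ p0); auto; [apply S; exact h1|].
    intros Hp. apply h3, S', Hp.
Qed.

(** * Left multiplication with an unchanged bottom forest *)

Lemma affine_comp f h a b : a < b -> f a < f b ->
  (forall t, a <= t <= b -> f t = f a + (t - a) * (f b - f a) / (b - a)) ->
  (forall t, f a <= t <= f b -> h t = h (f a) + (t - f a) * (h (f b) - h (f a)) / (f b - f a)) ->
  forall t, a <= t <= b -> h (f t) = h (f a) + (t - a) * (h (f b) - h (f a)) / (b - a).
Proof.
  intros hab hf HL HL' t Ht.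
  assert (Hft : f a <= f t <= f b).
  { rewrite (HL t Ht). assert (0 <= (t - a) * (f b - f a) / (b - a) <= f b - f a); [|lra].
    split.
    - apply Rmult_le_pos; [nra|]. left. apply Rinv_0_lt_compat. lra.
    - apply (Rmult_le_reg_r (b - a)); [lra|]. unfold Rdiv.
      rewrite Rmult_assoc, Rinv_l by lra. nra. }
  rewrite (HL' (f t) Hft), (HL t Ht). field. lra.
Qed.

Lemma diagram_comp D f h F : diagram_of D f ->
  (forall c d, is_leaf (dtop D) c d -> is_leaf F (h c) (h d) /\
     forall t, c <= t <= d -> h t = h c + (t - c) * (h d - h c) / (d - c)) ->
  diagram_of {| dbot := dbot D; dtop := F |} (fun t => h (f t)).
Proof.
  intros HD Hh a b Hab. cbn [dbot dtop] in *.
  destruct (HD _ _ Hab) as [Hl HL]. destruct (Hh _ _ Hl) as [Hl' HL'].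
  split; [exact Hl'|].
  apply affine_comp; auto; [exact (is_leaf_lt _ _ _ Hab)|exact (is_leaf_lt _ _ _ Hl)].
Qed.

(** If every exposed caret of the new top forest comes from an exposed caret of the old one, an
    opposing pair in the new diagram pulls back through [h] to one in the old diagram. *)
Lemma reduced_comp D f h F : reduced D f -> homeo h ->
  (forall c d, is_ecaret F c d -> exists c' d', is_ecaret (dtop D) c' d' /\
     h c' = c /\ h ((c' + d') / 2) = (c + d) / 2 /\ h d' = d) ->
  reduced {| dbot := dbot D; dtop := F |} (fun t => h (f t)).
Proof.
  intros HR Hh H (a & b & c & d & Hab & Hcd & E1 & E2 & E3). cbn [dbot dtop] in *.
  destruct (H _ _ Hcd) as (c' & d' & Hcd' & G1 & G2 & G3).
  apply HR. exists a, b, c', d'. repeat split; auto; apply (homeo_inj h); auto; congruence.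
Qed.

(** * Moving the pointer *)

Lemma unit_index (i j : Z) t : IZR i <= t < IZR i + 1 -> IZR j <= t < IZR j + 1 -> i = j.
Proof.
  intros H1 H2. destruct (Z.eq_dec i j) as [|n]; auto. apply unit_disjoint in n. lra.
Qed.

Lemma caret_of_leaf F u v c : is_leaf F u v -> is_caret F u c ->
  exists i, in_tree F i u v /\ In (u, c) (tcarets (ftree F i) (IZR i) (IZR i + 1)) /\ v < c.
Proof.
  intros [i Hi] [j Hj].
  pose proof (in_tree_bounds _ _ _ _ Hi).
  pose proof (tcarets_bounds _ _ _ _ _ (Rlt_plus_1 _) Hj).
  assert (i = j) by (apply (unit_index i j u); lra). subst j.
  exists i. repeat split; auto.
  apply (leaf_in_caret (ftree F i) (IZR i) (IZR i + 1) u v c); auto. lra.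
Qed.

Lemma label_spec F x :
  (label_of F x = LL /\ left_exterior x) \/
  (label_of F x = NN /\ ~ left_exterior x /\ left_of_caret F x) \/
  (label_of F x = RR /\ ~ left_exterior x /\ ~ left_of_caret F x /\ exterior x) \/
  (label_of F x = II /\ ~ left_of_caret F x /\ ~ exterior x).
Proof.
  unfold label_of.
  destruct (classic (left_exterior x)) as [h1|h1]; [rewrite (dec_true _ h1); auto 7|].
  rewrite (dec_false _ h1).
  destruct (classic (left_of_caret F x)) as [h2|h2]; [rewrite (dec_true _ h2); auto 7|].
  rewrite (dec_false _ h2).
  destruct (classic (exterior x)) as [h3|h3]; [rewrite (dec_true _ h3); auto 7|].
  rewrite (dec_false _ h3). auto 7.
Qed.

(** L takes priority over N, so carets need to be compared only away from the left exterior
    spaces. *)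
Lemma label_ext F G x y : (left_exterior x <-> left_exterior y) ->
  (~ left_exterior x -> (left_of_caret F x <-> left_of_caret G y)) ->
  (exterior x <-> exterior y) -> label_of F x = label_of G y.
Proof.
  intros H1 H2 H3. unfold label_of. rewrite (dec_ext _ _ H1), (dec_ext _ _ H3).
  destruct (classic (left_exterior y)) as [h|h].
  - rewrite dec_true by exact h. reflexivity.
  - rewrite (dec_false _ h). rewrite (dec_ext (left_of_caret F x) (left_of_caret G y)); tauto.
Qed.

Lemma left_exterior_IZR i : left_exterior (IZR i) <-> (i <= 0)%Z.
Proof.
  split; [|exists i; auto]. intros (j & E & H). apply eq_IZR in E. lia.
Qed.

Lemma left_exterior_exterior x : left_exterior x -> exterior x.
Proof. intros (i & E & _). exists i. exact E. Qed.

Lemma required_col_leaf D f a b : homeo f -> diagram_of D f -> required_col D f a b ->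
  is_leaf (dbot D) a b.
Proof.
  intros Hf HD [(i & Hi & _)|(i & Hi & _)]; [exists i; exact Hi|].
  destruct (top_leaf_preimage D f (f a) (f b) HD Hf) as (a' & b' & H & Ea & Eb);
    [exists i; exact Hi|].
  apply (homeo_inj f) in Ea, Eb; auto. subst. exact H.
Qed.

(** The pointer always marks the tree with index 0, so moving it by [k] is encoded as renumbering
    the trees, which matches composition with the translation by [-k]. *)
Definition shift (k : Z) (F : forest) : forest :=
  {| flo := flo F - k; ftrees := ftrees F |}.

Lemma ftree_shift k F i : ftree (shift k F) i = ftree F (i + k).
Proof.
  unfold ftree, shift; simpl.
  destruct (Z.ltb_spec i (flo F - k)), (Z.ltb_spec (i + k) (flo F)); try lia; auto.
  f_equal. lia.
Qed.

Lemma translate_affine c : midpoint_affine (fun t => t - c).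
Proof. intros s t. field. Qed.

Lemma double_affine : midpoint_affine (fun t => 2 * t).
Proof. intros s t. field. Qed.

Lemma halve_affine : midpoint_affine (fun t => t / 2).
Proof. intros s t. field. Qed.

Lemma shift_leaves k F i a b :
  in_tree (shift k F) i (a - IZR k) (b - IZR k) <-> in_tree F (i + k) a b.
Proof.
  unfold in_tree. rewrite ftree_shift.
  rewrite (tleaves_image (fun t => t - IZR k) _ (IZR (i + k)) (IZR (i + k) + 1))
    by (apply translate_affine || (rewrite plus_IZR; ring)). split.
  - intros (a' & b' & H & Ea & Eb).
    replace a with a' by lra. replace b with b' by lra. exact H.
  - intros H. exists a, b. auto.
Qed.

Lemma shift_carets k F a b :
  is_caret (shift k F) (a - IZR k) (b - IZR k) <-> is_caret F a b.
Proof.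
  assert (E : forall i, In (a - IZR k, b - IZR k) (tcarets (ftree (shift k F) i) (IZR i) (IZR i + 1))
    <-> In (a, b) (tcarets (ftree F (i + k)) (IZR (i + k)) (IZR (i + k) + 1))).
  { intros i. rewrite ftree_shift.
    rewrite (tcarets_image (fun t => t - IZR k) _ (IZR (i + k)) (IZR (i + k) + 1))
      by (apply translate_affine || (rewrite plus_IZR; ring)). split.
    - intros (a' & b' & H & Ea & Eb).
      replace a with a' by lra. replace b with b' by lra. exact H.
    - intros H. exists a, b. auto. }
  split; intros [i Hi].
  - exists (i + k)%Z. apply E, Hi.
  - exists (i - k)%Z. apply E. replace (i - k + k)%Z with i by lia. exact Hi.
Qed.

Lemma shift_ecarets k F a b :
  is_ecaret (shift k F) a b -> is_ecaret F (a + IZR k) (b + IZR k).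
Proof.
  intros [i Hi]. exists (i + k)%Z. rewrite ftree_shift in Hi.
  rewrite (tecarets_image (fun t => t - IZR k) _ (IZR (i + k)) (IZR (i + k) + 1)) in Hi
    by (apply translate_affine || (rewrite plus_IZR; ring)).
  destruct Hi as (a' & b' & H & -> & ->).
  replace (a' - IZR k + IZR k) with a' by ring. replace (b' - IZR k + IZR k) with b' by ring.
  exact H.
Qed.

Lemma shift_left_of_caret k F x :
  left_of_caret (shift k F) (x - IZR k) <-> left_of_caret F x.
Proof.
  split; intros [c H].
  - exists (c + IZR k). apply (shift_carets k).
    replace (c + IZR k - IZR k) with c by ring. exact H.
  - exists (c - IZR k). apply shift_carets, H.
Qed.

Lemma shift_exterior k x : exterior (x - IZR k) <-> exterior x.
Proof.
  split; intros [i H].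
  - exists (i + k)%Z. rewrite plus_IZR. lra.
  - exists (i - k)%Z. rewrite minus_IZR. lra.
Qed.

Lemma shift_left_exterior k x :
  left_exterior (x - IZR k) <-> exists i, x = IZR i /\ (i <= k)%Z.
Proof.
  split; intros (i & E & H).
  - exists (i + k)%Z. rewrite plus_IZR. split; [lra|lia].
  - exists (i - k)%Z. rewrite minus_IZR. split; [lra|lia].
Qed.

Definition shift_top (k : Z) (D : fdiag) : fdiag :=
  {| dbot := dbot D; dtop := shift k (dtop D) |}.

Lemma translation_homeo h k : (forall t, h t = t - IZR k) -> homeo h.
Proof.
  intros Hh. split.
  - intros s t. rewrite !Hh. lra.
  - intros y. exists (y + IZR k). rewrite Hh. ring.
Qed.

Lemma shift_reduced_diagram D f h k : reduced_diagram_of D f ->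
  (forall t, h t = t - IZR k) -> reduced_diagram_of (shift_top k D) (fun t => h (f t)).
Proof.
  intros [HD HR] Hh. split.
  - apply diagram_comp; [exact HD|]. intros c d Hl. split.
    + destruct Hl as [i Hi]. exists (i - k)%Z. rewrite !Hh. apply shift_leaves.
      replace (i - k + k)%Z with i by lia. exact Hi.
    + intros t _. apply is_leaf_lt in Hl. rewrite !Hh. field. lra.
  - apply reduced_comp; [exact HR|exact (translation_homeo h k Hh)|].
    intros c d H. exists (c + IZR k), (d + IZR k). split; [apply shift_ecarets; exact H|].
    rewrite !Hh. repeat split; field.
Qed.

Lemma required_shift D f h k a b : (forall t, h t = t - IZR k) ->
  required_col (shift_top k D) (fun t => h (f t)) a b ->
  (exists i, in_tree (dbot D) i a b /\ (ftree (dbot D) i <> Leaf \/ i = 0%Z)) \/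
  (exists i, in_tree (dtop D) i (f a) (f b) /\ (ftree (dtop D) i <> Leaf \/ i = k)).
Proof.
  intros Hh [H|(i & Hi & Hi')]; [left; exact H|right].
  exists (i + k)%Z. rewrite !Hh in Hi. apply shift_leaves in Hi. split; [exact Hi|].
  rewrite <- ftree_shift. destruct Hi' as [|Hi']; [left; auto|right; lia].
Qed.

(** Moving the pointer can make at most one column newly required: the leaf of the newly marked
    tree, if that tree is trivial. *)
Lemma required_shift_old D f h k a b : (forall t, h t = t - IZR k) ->
  required_col (shift_top k D) (fun t => h (f t)) a b ->
  required_col D f a b \/ (f a = IZR k /\ f b = IZR k + 1).
Proof.
  intros Hh H. apply required_shift in H as [H|(i & Hi & Hi')]; auto; [left; left; exact H|].
  destruct (classic (ftree (dtop D) i = Leaf)) as [E|E].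
  - destruct Hi' as [Hi'|Hi']; [contradiction|]. subst i.
    right. exact (in_trivial_tree _ _ _ _ E Hi).
  - left; right. exists i. auto.
Qed.

(* [v] is the one space between the old and the new current tree, so it is the
   only space whose label changes. *)
Lemma pointer_move D f k h v : homeo f -> reduced_diagram_of D f ->
  (forall t, h t = t - IZR k) ->
  (forall a b, f a = IZR k -> f b = IZR k + 1 -> a = v \/ b = v) ->
  (forall x, x <> f v -> label_of (shift k (dtop D)) (h x) = label_of (dtop D) x) ->
  support_space D f v -> (0 < space_weight D f v)%nat ->
  (support_space (shift_top k D) (fun t => h (f t)) v ->
    (space_weight (shift_top k D) (fun t => h (f t)) v < space_weight D f v)%nat) ->
  (ell (fun t => h (f t)) < ell f)%nat.
Proof.
  intros Hf HD Hh Hadj Hlab Hv Hw Hlt.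
  pose proof (translation_homeo h k Hh) as Hhh.
  pose proof (shift_reduced_diagram D f h k HD Hh) as HD'.
  assert (Hg : homeo (fun t => h (f t))) by (apply homeo_comp; auto).
  pose proof Hv as ([e He] & (a3 & b3 & R3 & h3) & (a4 & b4 & R4 & h4)).
  apply (ell_decreases D (shift_top k D)); auto.
  2: { right. exists v. auto. }
  intros p Hp.
  (* The support does not grow: a newly required column has [v] as an endpoint, so a space beyond it
     is [v] or lies beyond [v], and the old columns that put [v] into the support serve for this
     space too. *)
  assert (Hs : support_space D f p).
  { destruct Hp as ([q Hq] & (a1 & b1 & R1 & h1) & (a2 & b2 & R2 & h2)).
    cbn [shift_top dbot] in Hq.
    pose proof (required_col_leaf _ _ _ _ Hg (proj1 HD') R1) as L1.
    pose proof (required_col_leaf _ _ _ _ Hg (proj1 HD') R2) as L2.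
    cbn [shift_top dbot] in L1, L2.
    pose proof (is_leaf_lt _ _ _ L1). pose proof (is_leaf_lt _ _ _ L2).
    pose proof (is_leaf_lt _ _ _ Hq).
    split; [eauto|]. split.
    - apply required_shift_old in R1 as [R1|[E1 E2]]; [eauto| |exact Hh].
      assert (v <= p); [|exists a3, b3; split; [exact R3|lra]].
      destruct (Hadj _ _ E1 E2); [lra|].
      pose proof (leaf_disjoint _ _ _ _ _ L1 Hq). lra.
    - apply required_shift_old in R2 as [R2|[E1 E2]]; [eauto| |exact Hh].
      assert (p <= v); [|exists a4, b4; split; [exact R4|lra]].
      destruct (Hadj _ _ E1 E2); [|lra].
      pose proof (leaf_disjoint _ _ _ _ _ L2 Hq). lra. }
  split; [exact Hs|].
  destruct (Req_dec p v) as [->|n]; [apply Nat.lt_le_incl, Hlt, Hp|].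
  unfold space_weight; cbn [shift_top dbot dtop]. rewrite Hlab; [lia|].
  intros E. apply n, (homeo_inj f); auto.
Qed.

(** The top label at [v] changes from R or N to L. With bottom L the weight would rise from 1 to 2,
    so [v] has to leave the support. For the other bottom labels it falls from 2 to 1, except for
    the pair (R,I) of weight 0, which the last disjunction excludes. *)
Lemma move_right D f h v : homeo f -> reduced_diagram_of D f ->
  (forall t, h t = t - 1) -> f v = 1 -> support_space D f v ->
  (label_of (dbot D) v = LL /\ ~ support_space (shift_top 1 D) (fun t => h (f t)) v) \/
  (label_of (dbot D) v <> LL /\ (left_of_caret (dtop D) 1 \/ label_of (dbot D) v <> II)) ->
  (ell (fun t => h (f t)) < ell f)%nat.
Proof.
  intros Hf HD Hh Hv Hs Hc.
  assert (Hold : label_of (dtop D) 1 = RR \/ label_of (dtop D) 1 = NN).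
  { destruct (label_spec (dtop D) 1) as [[_ E]|[[E _]|[[E _]|[_ [_ E]]]]]; auto.
    - apply (left_exterior_IZR 1) in E. lia.
    - exfalso. apply E. exists 1%Z. reflexivity. }
  assert (Hold' : left_of_caret (dtop D) 1 -> label_of (dtop D) 1 = NN).
  { destruct (label_spec (dtop D) 1) as [[_ E]|[[E _]|[[_ [_ [E _]]]|[_ [E _]]]]]; auto; try contradiction.
    apply (left_exterior_IZR 1) in E. lia. }
  assert (Hnew : label_of (shift 1 (dtop D)) (h 1) = LL).
  { unfold label_of. rewrite dec_true; [reflexivity|]. rewrite Hh.
    apply (shift_left_exterior 1). exists 1%Z. split; [reflexivity|lia]. }
  apply (pointer_move D f 1 h v); auto.
  - intros a b Ha _. left. apply (homeo_inj f); auto. lra.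
  - intros x Hx. rewrite Hh, Hv in *. apply label_ext.
    + rewrite (shift_left_exterior 1). split; intros (i & E & Hi); exists i; (split; [exact E|]); [|lia].
      assert (i <> 1%Z) by (intros ->; auto). lia.
    + intros _. apply (shift_left_of_caret 1).
    + apply (shift_exterior 1).
  - unfold space_weight. rewrite Hv.
    destruct Hold as [E|E]; rewrite E; destruct (label_of (dbot D) v); simpl; try lia.
    exfalso. destruct Hc as [[Hc _]|[_ [Hc|Hc]]]; [discriminate| |congruence].
    apply Hold' in Hc. congruence.
  - intros Hs'. unfold space_weight. cbn [shift_top dbot dtop]. rewrite Hv, Hnew.
    destruct Hc as [[_ Hc]|[Hc1 Hc2]]; [contradiction|].
    destruct Hold as [E|E]; rewrite E; destruct (label_of (dbot D) v); simpl; try lia; try congruence.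
    exfalso. destruct Hc2 as [Hc|Hc]; [|congruence].
    apply Hold' in Hc. congruence.
Qed.

(** The top label at [u] changes from L to R, not to N, because the tree being uncovered is trivial
    and no caret starts there. This gains for bottom L (2 to 1) and I (1 to 0); otherwise [u] has to
    leave the support. *)
Lemma move_left D f h u : homeo f -> reduced_diagram_of D f ->
  (forall t, h t = t + 1) -> f u = 0 -> ftree (dtop D) 0 = Leaf -> support_space D f u ->
  label_of (dbot D) u = LL \/ label_of (dbot D) u = II \/
  ~ support_space (shift_top (-1) D) (fun t => h (f t)) u ->
  (ell (fun t => h (f t)) < ell f)%nat.
Proof.
  intros Hf HD Hh Hu H0 Hs Hc.
  assert (Hh' : forall t, h t = t - IZR (-1)) by (intros t; rewrite Hh; simpl; lra).
  assert (Hold : label_of (dtop D) 0 = LL).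
  { unfold label_of. rewrite dec_true; [reflexivity|]. exists 0%Z. split; [reflexivity|lia]. }
  assert (Hnew : label_of (shift (-1) (dtop D)) (h 0) = RR).
  { rewrite Hh'. destruct (label_spec (shift (-1) (dtop D)) (0 - IZR (-1)))
      as [[_ h1]|[[_ [_ h1]]|[[h1 _]|[_ [_ h1]]]]]; auto; exfalso.
    - apply (proj1 (shift_left_exterior (-1) _)) in h1 as (i & E & Hi). apply (eq_IZR 0) in E. lia.
    - apply (proj1 (shift_left_of_caret (-1) _ _)) in h1 as [c h1].
      destruct (caret_of_leaf (dtop D) 0 1 c) as (i & Hi & Hi' & _); auto.
      + exists 0%Z. replace 1 with (0 + 1) by ring. apply (trivial_tree_leaf _ 0), H0.
      + apply tcarets_nonleaf in Hi'.
        replace 1 with (IZR 0 + 1) in Hi by ring.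
        apply (in_tree_full _ i 0) in Hi. destruct Hi as [_ Hi]. contradiction.
    - apply h1, (proj2 (shift_exterior (-1) _)). exists 0%Z. reflexivity. }
  apply (pointer_move D f (-1) h u); auto.
  - intros a b _ Hb. right. apply (homeo_inj f); auto. simpl in Hb. lra.
  - intros x Hx. rewrite Hh', Hu in *. apply label_ext.
    + rewrite (shift_left_exterior (-1)). split; intros (i & E & Hi); exists i; (split; [exact E|]); [lia|].
      assert (i <> 0%Z) by (intros ->; auto). lia.
    + intros _. apply (shift_left_of_caret (-1)).
    + apply (shift_exterior (-1)).
  - unfold space_weight. rewrite Hu, Hold. destruct (label_of (dbot D) u); simpl; lia.
  - intros Hs'. unfold space_weight. cbn [shift_top dbot dtop]. rewrite Hu, Hnew, Hold.
    destruct Hc as [E|[E|E]]; [| |contradiction]; rewrite E; simpl; lia.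
Qed.

(** * Splitting the current tree *)

Lemma x1_neg t : t <= 0 -> x1 t = t.
Proof. intros. unfold x1. destruct (Rle_dec t 0); lra. Qed.

Lemma x1_mid t : 0 <= t <= 2 -> x1 t = t / 2.
Proof. intros. unfold x1. destruct (Rle_dec t 0), (Rle_dec t 2); lra. Qed.

Lemma x1_pos t : 2 <= t -> x1 t = t - 1.
Proof. intros. unfold x1. destruct (Rle_dec t 0), (Rle_dec t 2); lra. Qed.

Lemma x1inv_neg t : t <= 0 -> x1inv t = t.
Proof. intros. unfold x1inv. destruct (Rle_dec t 0); lra. Qed.

Lemma x1inv_mid t : 0 <= t <= 1 -> x1inv t = 2 * t.
Proof. intros. unfold x1inv. destruct (Rle_dec t 0), (Rle_dec t 1); lra. Qed.

Lemma x1inv_pos t : 1 <= t -> x1inv t = t + 1.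
Proof. intros. unfold x1inv. destruct (Rle_dec t 0), (Rle_dec t 1); lra. Qed.

Lemma x1_x1inv t : x1 (x1inv t) = t.
Proof.
  unfold x1inv. destruct (Rle_dec t 0), (Rle_dec t 1); unfold x1;
    destruct (Rle_dec _ 0); try destruct (Rle_dec _ 2); lra.
Qed.

Lemma x1inv_x1 t : x1inv (x1 t) = t.
Proof.
  unfold x1. destruct (Rle_dec t 0), (Rle_dec t 2); unfold x1inv;
    destruct (Rle_dec _ 0); try destruct (Rle_dec _ 1); lra.
Qed.

Lemma x1_homeo : homeo x1.
Proof.
  split; [|intros y; exists (x1inv y); apply x1_x1inv].
  intros s t H. unfold x1.
  destruct (Rle_dec s 0), (Rle_dec s 2), (Rle_dec t 0), (Rle_dec t 2); lra.
Qed.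

Lemma x1inv_homeo : homeo x1inv.
Proof.
  split; [|intros y; exists (x1 y); apply x1inv_x1].
  intros s t H. unfold x1inv.
  destruct (Rle_dec s 0), (Rle_dec s 1), (Rle_dec t 0), (Rle_dec t 1); lra.
Qed.

Lemma tecarets_bounds T x y a b : x < y -> In (a, b) (tecarets T x y) ->
  x <= a /\ a < b /\ b <= y.
Proof.
  intros Hxy H. destruct (tecarets_halves _ _ _ _ _ H) as [H1 H2].
  apply tleaves_bounds in H1; [|exact Hxy]. apply tleaves_bounds in H2; [|exact Hxy]. lra.
Qed.

(* What the lists of leaves, of carets and of exposed carets have in common. *)
Definition natural_items (K : tree -> R -> R -> list (R * R)) : Prop :=
  (forall L T x y x' y' a b, midpoint_affine L -> x' = L x -> y' = L y ->
     In (a, b) (K T x' y') <-> exists a' b', In (a', b') (K T x y) /\ a = L a' /\ b = L b') /\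
  (forall T x y a b, x < y -> In (a, b) (K T x y) -> x <= a /\ a < b /\ b <= y).

Lemma natural_leaves : natural_items tleaves.
Proof. split; [exact tleaves_image|exact tleaves_bounds]. Qed.

Lemma natural_carets : natural_items tcarets.
Proof. split; [exact tcarets_image|exact tcarets_bounds]. Qed.

Lemma natural_ecarets : natural_items tecarets.
Proof. split; [exact tecarets_image|exact tecarets_bounds]. Qed.

Lemma natural_translate K T i j c d : natural_items K ->
  In (c, d) (K T (IZR i) (IZR i + 1)) ->
  In (c + IZR (j - i), d + IZR (j - i)) (K T (IZR j) (IZR j + 1)).
Proof.
  intros [HK _] H.
  apply (HK (fun t => t - - IZR (j - i)) T (IZR i) (IZR i + 1)).
  - apply translate_affine.
  - rewrite minus_IZR. ring.
  - rewrite minus_IZR. ring.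
  - exists c, d. repeat split; auto; ring.
Qed.

(** The effect of [x1inv] on the top forest: stretching [[0, 1]] onto [[0, 2]] dissolves the root
    caret of the current tree, its two subtrees become trees 0 and 1, and the trees further right
    move up by one. *)
Definition root_split (F F' : forest) (l r : tree) : Prop :=
  ftree F 0 = Node l r /\ ftree F' 0 = l /\ ftree F' 1 = r /\
  (forall j, (j < 0)%Z -> ftree F' j = ftree F j) /\
  (forall j, (0 < j)%Z -> ftree F' (j + 1) = ftree F j).

Lemma root_split_exists F l r : ftree F 0 = Node l r ->
  exists F', root_split F F' l r /\ ncarets F = S (ncarets F').
Proof.
  intros H. destruct (forest_replace F 0 [l; r]) as (F' & H1 & H2 & H3 & H4).
  exists F'. split.
  - split; [exact H|]. split; [apply (H2 0%nat); simpl; lia|].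
    split; [apply (H2 1%nat); simpl; lia|]. split; [exact H1|].
    intros j Hj. rewrite <- (H3 j Hj). f_equal. simpl. lia.
  - rewrite H in H4. simpl in H4. lia.
Qed.

(** The hypothesis on [K] is only an inclusion because the root itself is an item of [Node l r] when
    [K] lists carets. The last clause says that required columns come from required columns, tree 1
    having been part of the marked tree. *)
Lemma root_split_back K F F' l r j c d : natural_items K -> root_split F F' l r ->
  (forall q, In q (K l 0 (1 / 2)) \/ In q (K r (1 / 2) 1) -> In q (K (Node l r) 0 1)) ->
  In (c, d) (K (ftree F' j) (IZR j) (IZR j + 1)) ->
  exists i, In (x1 c, x1 d) (K (ftree F i) (IZR i) (IZR i + 1)) /\
    x1 ((c + d) / 2) = (x1 c + x1 d) / 2 /\
    (ftree F' j <> Leaf \/ j = 0%Z -> ftree F i <> Leaf \/ i = 0%Z).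
Proof.
  intros HK (E & El & Er & Hn & Hp) Hsub H.
  pose proof (proj2 HK _ _ _ _ _ (Rlt_plus_1 _) H) as B.
  destruct (Z.lt_trichotomy j 0) as [hj|[->|hj]].
  - exists j. pose proof (IZR_le (j + 1) 0) as hj'. rewrite plus_IZR in hj'.
    specialize (hj' ltac:(lia)). rewrite !x1_neg by lra. rewrite <- Hn by exact hj. auto.
  - exists 0%Z. rewrite !x1_mid by lra. rewrite E. split; [|split; [field|auto]].
    rewrite El in H. rewrite Rplus_0_l. apply Hsub. left.
    apply (proj1 HK (fun t => t / 2) l 0 1); [apply halve_affine|field|field|].
    exists c, d. rewrite Rplus_0_l in H. auto.
  - destruct (Z.eq_dec j 1) as [->|n].
    + exists 0%Z. rewrite !x1_mid by lra. rewrite E. split; [|split; [field|auto]].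
      rewrite Er in H. rewrite Rplus_0_l. apply Hsub. right.
      apply (proj1 HK (fun t => t / 2) r 1 2); [apply halve_affine|field|field|].
      exists c, d. replace (1 + 1) with 2 in H by ring. auto.
    + exists (j - 1)%Z. pose proof (IZR_le 2 j ltac:(lia)).
      rewrite !x1_pos by lra.
      assert (Et : ftree F' j = ftree F (j - 1)).
      { rewrite <- Hp by lia. f_equal. lia. }
      split; [|split; [field|]].
      * rewrite <- Et. pose proof (natural_translate K _ _ (j - 1) _ _ HK H) as G.
        replace (IZR (j - 1 - j)) with (-1) in G by (f_equal; lia).
        exact G.
      * rewrite <- Et. intros [h|h]; [left; exact h|lia].
Qed.

(** The hypothesis for [i = 0] excludes the one item that is lost, the root caret. *)
Lemma root_split_forth K F F' l r i c d : natural_items K -> root_split F F' l r ->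
  In (c, d) (K (ftree F i) (IZR i) (IZR i + 1)) ->
  (i = 0%Z -> In (c, d) (K l 0 (1 / 2)) \/ In (c, d) (K r (1 / 2) 1)) ->
  (exists j, In (x1inv c, x1inv d) (K (ftree F' j) (IZR j) (IZR j + 1))) /\
  forall t, c <= t <= d -> x1inv t = x1inv c + (t - c) * (x1inv d - x1inv c) / (d - c).
Proof.
  intros HK (E & El & Er & Hn & Hp) H H0.
  pose proof (proj2 HK _ _ _ _ _ (Rlt_plus_1 _) H) as B.
  destruct (Z.lt_trichotomy i 0) as [hi|[->|hi]].
  - pose proof (IZR_le (i + 1) 0) as hi'. rewrite plus_IZR in hi'.
    specialize (hi' ltac:(lia)). split.
    + exists i. rewrite !x1inv_neg by lra. rewrite Hn by exact hi. exact H.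
    + intros t Ht. rewrite !x1inv_neg by lra. field; lra.
  - split; [|intros t Ht; rewrite !x1inv_mid by lra; field; lra].
    rewrite !x1inv_mid by lra. destruct (H0 eq_refl) as [G|G].
    + exists 0%Z. rewrite El.
      apply (proj1 HK (fun t => 2 * t) l 0 (1 / 2)); [apply double_affine|field|field|].
      exists c, d. auto.
    + exists 1%Z. rewrite Er.
      apply (proj1 HK (fun t => 2 * t) r (1 / 2) 1); [apply double_affine|field|field|].
      exists c, d. auto.
  - pose proof (IZR_le 1 i ltac:(lia)). split.
    + exists (i + 1)%Z. rewrite !x1inv_pos by lra. rewrite Hp by exact hi.
      pose proof (natural_translate K _ _ (i + 1) _ _ HK H) as G.
      replace (IZR (i + 1 - i)) with 1 in G by (f_equal; lia). exact G.
    + intros t Ht. rewrite !x1inv_pos by lra. field; lra.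
Qed.

Lemma half_unit : (0 + 1) / 2 = 1 / 2.
Proof. field. Qed.

Lemma root_split_leaf_back F F' l r j c d : root_split F F' l r -> in_tree F' j c d ->
  exists i, in_tree F i (x1 c) (x1 d) /\
    (ftree F' j <> Leaf \/ j = 0%Z -> ftree F i <> Leaf \/ i = 0%Z).
Proof.
  intros HS H.
  destruct (root_split_back tleaves F F' l r j c d natural_leaves HS) as (i & H1 & _ & H2);
    [|exact H|exists i; auto].
  intros q. simpl. rewrite half_unit, in_app_iff. auto.
Qed.

(** The deleted root caret starts at 0, so only there can this property be lost. *)
Lemma root_split_left_of_caret F F' l r x : root_split F F' l r -> x <> 0 ->
  left_of_caret F x <-> left_of_caret F' (x1inv x).
Proof.
  intros HS Hx. split.
  - intros (c & i & H).
    destruct (root_split_forth tcarets F F' l r i x c natural_carets HS H) as [[j Hj] _].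
    + intros ->. destruct HS as [E _]. rewrite E in H. rewrite tcarets_node in H.
      destruct H as [H|H]; [injection H; intros; contradiction|].
      rewrite !Rplus_0_l in H. exact H.
    + exists (x1inv c), j. exact Hj.
  - intros (c & j & H).
    destruct (root_split_back tcarets F F' l r j (x1inv x) c natural_carets HS)
      as (i & H1 & _); [|exact H|].
    + intros q Hq. apply tcarets_node. rewrite half_unit. auto.
    + exists (x1 c), i. rewrite x1_x1inv in H1. exact H1.
Qed.

(** Only the point [1 / 2] turns from interior to exterior, becoming the integer 1. Its label
    survives if it is N and otherwise passes from I to R. *)
Lemma root_split_label F F' l r x : root_split F F' l r ->
  label_of F' (x1inv x) = label_of F x \/
  (x = 1 / 2 /\ label_of F x = II /\ label_of F' (x1inv x) = RR).
Proof.
  intros HS.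
  assert (Hle : left_exterior x <-> left_exterior (x1inv x)).
  { split; intros (i & E & Hi).
    - exists i. split; [|exact Hi]. pose proof (IZR_le _ _ Hi). rewrite x1inv_neg; lra.
    - exists i. split; [|exact Hi]. pose proof (IZR_le _ _ Hi).
      assert (x <= 0); [|rewrite x1inv_neg in E; lra].
      rewrite <- (x1_x1inv x). rewrite x1_neg; lra. }
  assert (Hc : ~ left_exterior x -> (left_of_caret F x <-> left_of_caret F' (x1inv x))).
  { intros Hx. apply (root_split_left_of_caret F F' l r); auto.
    intros ->. apply Hx. exists 0%Z. split; [reflexivity|lia]. }
  destruct (Req_dec x (1 / 2)) as [Ex|Nx].
  - assert (Nl : ~ left_exterior x).
    { intros (i & E & Hi). apply IZR_le in Hi. lra. }
    specialize (Hc Nl).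
    assert (E1 : x1inv x = 1) by (rewrite x1inv_mid; lra).
    destruct (label_spec F x) as [h|[h|[h|h]]].
    + tauto.
    + left. destruct (label_spec F' (x1inv x)) as [g|[g|[g|g]]]; try tauto.
      destruct h as [-> _], g as [-> _]. reflexivity.
    + exfalso. destruct h as (_ & _ & _ & i & E).
      assert (0 < i)%Z by (apply lt_IZR; lra). assert (i < 1)%Z by (apply lt_IZR; lra). lia.
    + right. destruct (label_spec F' (x1inv x)) as [g|[g|[g|g]]]; try tauto.
      exfalso. apply g. exists 1%Z. exact E1.
  - left. symmetry. apply label_ext; auto.
    destruct (Rle_lt_dec x 0); [rewrite x1inv_neg by lra; tauto|].
    destruct (Rle_lt_dec 1 x).
    + rewrite x1inv_pos by lra. symmetry.
      replace (x + 1) with (x - IZR (-1)) by (simpl; ring). apply shift_exterior.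
    + rewrite x1inv_mid by lra. split; intros [i E]; exfalso.
      * assert (0 < i)%Z by (apply lt_IZR; lra). assert (i < 1)%Z by (apply lt_IZR; lra). lia.
      * assert (0 < i)%Z by (apply lt_IZR; lra). assert (i < 2)%Z by (apply lt_IZR; lra).
        assert (i = 1%Z) by lia. subst. lra.
Qed.

Lemma root_split_reduced_diagram D f F' l r : reduced_diagram_of D f ->
  root_split (dtop D) F' l r ->
  reduced_diagram_of {| dbot := dbot D; dtop := F' |} (fun t => x1inv (f t)).
Proof.
  intros [HD HR] HS. split.
  - apply diagram_comp; [exact HD|]. intros c d [i Hi].
    apply (root_split_forth tleaves (dtop D) F' l r i c d natural_leaves HS Hi).
    intros ->. destruct HS as [E _]. unfold in_tree in Hi. rewrite E in Hi. simpl in Hi.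
    rewrite !Rplus_0_l, in_app_iff in Hi. exact Hi.
  - apply reduced_comp; [exact HR|exact x1inv_homeo|]. intros c d [j Hj].
    destruct (root_split_back tecarets (dtop D) F' l r j c d natural_ecarets HS)
      as (i & H1 & H2 & _); [|exact Hj|].
    + intros q Hq. apply tecarets_node. rewrite half_unit. auto.
    + exists (x1 c), (x1 d). split; [exists i; exact H1|].
      rewrite <- H2, !x1inv_x1. auto.
Qed.

Lemma current_tree_nontrivial D f : homeo f -> reduced_diagram_of D f ->
  ftree (dtop D) 0 <> Leaf ->
  (ell (fun t => x1inv (f t)) < ell f)%nat \/ (ell (fun t => x0 (f t)) < ell f)%nat.
Proof.
  intros Hf HD H0. destruct (ftree (dtop D) 0) as [|l r] eqn:E0; [contradiction|]. clear H0.
  destruct (root_split_exists _ _ _ E0) as (F' & HS & Hn).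
  pose proof (root_split_reduced_diagram D f F' l r HD HS) as HD'.
  set (D' := {| dbot := dbot D; dtop := F' |}) in *.
  set (g := fun t => x1inv (f t)) in *.
  assert (Hg : homeo g) by exact (homeo_comp _ _ x1inv_homeo Hf).
  assert (HR : forall a b, required_col D' g a b -> required_col D f a b).
  { intros a b [H|(j & Hj & Hj')]; [left; exact H|right].
    destruct (root_split_leaf_back _ _ _ _ _ _ _ HS Hj) as (i & Hi & Hi').
    unfold g in Hi. rewrite !x1_x1inv in Hi. exists i. auto. }
  assert (HSup : forall p, support_space D' g p -> support_space D f p).
  { intros p (Hp & (a1 & b1 & R1 & h1) & (a2 & b2 & R2 & h2)).
    split; [exact Hp|]. split; eauto. }
  (* Passing from I to R on top leaves the weight unchanged for bottom L, N and I. Only bottom R is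
     harmful: the weight rises from 0 to 2, more than the one caret that is saved. *)
  destruct (classic (exists p, support_space D' g p /\ f p = 1 / 2 /\
    label_of (dtop D) (f p) = II /\ label_of (dbot D) p = RR)) as [Hbad|Hgood].
  - right. destruct Hbad as (p & Hp & Ep & Lt & Lb).
    assert (Hcp : ~ left_of_caret (dtop D) (f p)).
    { destruct (label_spec (dtop D) (f p)) as [h|[h|[h|h]]]; intuition congruence. }
    assert (Hbp : ~ left_of_caret (dbot D) p /\ exists j, p = IZR j /\ (0 < j)%Z).
    { destruct (label_spec (dbot D) p) as [h|[h|[h|h]]]; try intuition congruence.
      destruct h as (_ & h1 & h2 & j & ->). split; [exact h2|]. exists j. split; [reflexivity|].
      rewrite left_exterior_IZR in h1. lia. }
    destruct Hbp as (Hbp & j & -> & Hj).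
    assert (Ej : ftree (dbot D) j = Leaf).
    { apply NNPP. intros n. apply Hbp. exists (IZR j + 1), j. apply tcarets_root, n. }
    pose proof (trivial_tree_leaf _ _ Ej) as Lj.
    assert (Er : r = Leaf).
    { apply NNPP. intros n. apply Hcp. rewrite Ep. exists 1, 0%Z. rewrite E0.
      apply tcarets_node. right; right. rewrite !Rplus_0_l. apply tcarets_root, n. }
    (* The bottom label R makes [[j, j + 1]] a trivial tree, and the top label I makes the right
       subtree of the root a leaf. These two leaves are matched, so the space right of the current
       tree is [j + 1]. *)
    assert (E1 : f (IZR j + 1) = 1).
    { assert (T : is_leaf (dtop D) (1 / 2) 1).
      { exists 0%Z. unfold in_tree. rewrite E0, Er. simpl. apply in_app_iff. right. simpl.
        left. f_equal; field. }
      destruct (proj1 HD _ _ (ex_intro _ j Lj)) as [T' _].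
      pose proof (is_leaf_lt _ _ _ T').
      eapply (leaf_overlap (dtop D)); [exact T'|exact T|lra|lra]. }
    apply (move_right D f x0 (IZR j + 1)); auto.
    + pose proof Hp as (_ & (a1 & b1 & R1 & h1) & (a2 & b2 & R2 & h2)).
      split; [exists (IZR j), j; exact Lj|].
      split; [exists a1, b1; split; [auto|lra]|].
      (* Otherwise the required column witnessing [p < b2] would be [[j, j + 1]] itself. But after
         the split both trees containing it are trivial and unmarked. *)
      exists a2, b2. split; [auto|]. apply Rnot_le_lt. intros n.
      pose proof (required_col_leaf _ _ _ _ Hg (proj1 HD') R2) as L2. cbn [D' dbot] in L2.
      destruct (leaf_overlap _ _ _ _ _ L2 (ex_intro _ j Lj)) as [-> ->];
        [lra|apply is_leaf_lt in L2; lra|].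
      destruct R2 as [(i & Hi & Hi')|(i & Hi & Hi')]; cbn [D' dbot dtop] in *.
      * apply in_tree_full in Hi as [-> _]. destruct Hi' as [h|h]; [contradiction|lia].
      * unfold g in Hi. rewrite Ep, E1, x1inv_mid, x1inv_pos in Hi by lra.
        replace (2 * (1 / 2)) with 1 in Hi by field.
        apply (in_tree_full _ i 1) in Hi as [-> _].
        destruct HS as (_ & _ & E & _). rewrite E, Er in Hi'.
        destruct Hi' as [h|h]; [contradiction|lia].
    + right.
      destruct (label_spec (dbot D) (IZR j + 1)) as [[_ h]|[[h _]|[[h _]|[_ [_ h]]]]].
      * rewrite <- plus_IZR in h. apply left_exterior_IZR in h. lia.
      * rewrite h. split; [discriminate|right; discriminate].
      * rewrite h. split; [discriminate|right; discriminate].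
      * exfalso. apply h. exists (j + 1)%Z. apply eq_sym, plus_IZR.
  - left. apply (ell_decreases D D'); auto; cbn [D' dbot dtop]; try lia.
    intros p Hp. split; [auto|]. unfold space_weight. cbn [D' dbot dtop]. unfold g.
    destruct (root_split_label _ _ _ _ (f p) HS) as [->|(E1 & E2 & E3)]; [lia|].
    rewrite E2, E3. destruct (label_of (dbot D) p) eqn:E4; simpl; try lia.
    exfalso. apply Hgood. exists p. auto.
Qed.

(** * Cancelling a bottom caret *)

Lemma forest_prune F a b : is_ecaret F a b -> exists F',
  ncarets F = S (ncarets F') /\ is_leaf F' a b /\
  (forall j c d, in_tree F' j c d -> (c = a /\ d = b) \/ in_tree F j c d) /\
  (forall j, ftree F' j <> Leaf -> ftree F j <> Leaf) /\
  (forall c d, is_caret F' c d -> is_caret F c d) /\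
  (forall c d, is_caret F c d -> (c = a /\ d = b) \/ is_caret F' c d) /\
  (forall c d, is_ecaret F' c d ->
     is_ecaret F c d \/ (c = a /\ (c + d) / 2 = b) \/ ((c + d) / 2 = a /\ d = b)).
Proof.
  intros [i Hi].
  destruct (prune _ _ _ _ _ (Rlt_plus_1 _) Hi) as (T' & P1 & P2 & P3 & P4 & P5 & P6).
  destruct (forest_replace F i [T']) as (F' & H1 & H2 & H3 & H4).
  assert (Ei : ftree F' i = T').
  { rewrite <- (Z.add_0_r i). exact (H2 0%nat Nat.lt_0_1). }
  assert (Ej : forall j, j <> i -> ftree F' j = ftree F j).
  { intros j n. destruct (Z.lt_total j i) as [h|[h|h]]; [auto|contradiction|].
    rewrite <- (H3 j h). f_equal. simpl. lia. }
  clear H1 H2 H3. exists F'.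
  assert (C : forall j, j = i \/ j <> i) by (intros; lia).
  split; [simpl in H4; lia|]. split; [exists i; unfold in_tree; rewrite Ei; exact P2|].
  split; [intros j c d H; unfold in_tree in *; destruct (C j) as [->|n];
    [rewrite Ei in H; apply P3, H|right; rewrite <- Ej; auto]|].
  split; [intros j; destruct (C j) as [->|n];
    [intros _; exact (tecarets_nonleaf _ _ _ _ Hi)|rewrite Ej; auto]|].
  split; [intros c d [j H]; exists j; destruct (C j) as [->|n];
    [rewrite Ei in H; apply P4, H|rewrite <- Ej; auto]|].
  split; [intros c d [j H]; destruct (C j) as [->|n];
    [apply P5 in H as [H|H]; [auto|right; exists i; rewrite Ei; exact H]
    |right; exists j; rewrite Ej; auto]|].
  intros c d [j H]. destruct (C j) as [->|n].
  - rewrite Ei in H. apply P6 in H as [H|H]; [left; exists i; exact H|auto].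
  - left. exists j. rewrite <- Ej; auto.
Qed.

(** Multiplying by [x1] would put a caret over trees 0 and 1, which then cancels against the bottom
    caret. Dropping one of the two trivial trees gives the top forest after this cancellation
    directly. *)
Definition top_merge (F F' : forest) : Prop :=
  ftree F 0 = Leaf /\ ftree F 1 = Leaf /\ ftree F' 0 = Leaf /\
  (forall j, (j < 0)%Z -> ftree F' j = ftree F j) /\
  (forall j, (0 < j)%Z -> ftree F' j = ftree F (j + 1)).

Lemma top_merge_exists F : ftree F 0 = Leaf -> ftree F 1 = Leaf ->
  exists F', top_merge F F' /\ ncarets F = ncarets F'.
Proof.
  (* Tree 0 is replaced by the empty list, so the old tree 1 takes its place. *)
  intros H0 H1. destruct (forest_replace F 0 []) as (F' & G1 & _ & G3 & G4).
  exists F'. rewrite H0 in G4. simpl in G4. split; [|lia].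
  assert (G : forall j, (0 <= j)%Z -> ftree F' j = ftree F (j + 1)).
  { intros j Hj. rewrite <- G3 by lia. f_equal. simpl. lia. }
  split; [exact H0|]. split; [exact H1|]. split; [rewrite G by lia; exact H1|].
  split; [exact G1|]. intros j Hj. apply G. lia.
Qed.

Lemma top_merge_forth K F F' i c d : natural_items K -> top_merge F F' ->
  In (c, d) (K (ftree F i) (IZR i) (IZR i + 1)) -> i <> 0%Z -> i <> 1%Z ->
  (exists j, In (x1 c, x1 d) (K (ftree F' j) (IZR j) (IZR j + 1))) /\
  forall t, c <= t <= d -> x1 t = x1 c + (t - c) * (x1 d - x1 c) / (d - c).
Proof.
  intros HK (_ & _ & _ & Hn & Hp) H n0 n1.
  pose proof (proj2 HK _ _ _ _ _ (Rlt_plus_1 _) H) as B.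
  destruct (Z.lt_total i 0) as [hi|[|hi]]; [|contradiction|].
  - pose proof (IZR_le (i + 1) 0) as hi'. rewrite plus_IZR in hi'.
    specialize (hi' ltac:(lia)). split.
    + exists i. rewrite !x1_neg by lra. rewrite Hn by exact hi. exact H.
    + intros t Ht. rewrite !x1_neg by lra. field; lra.
  - pose proof (IZR_le 2 i ltac:(lia)). split.
    + exists (i - 1)%Z. rewrite !x1_pos by lra. rewrite Hp by lia.
      replace (i - 1 + 1)%Z with i by lia.
      pose proof (natural_translate K _ _ (i - 1) _ _ HK H) as G.
      replace (IZR (i - 1 - i)) with (-1) in G by (f_equal; lia). exact G.
    + intros t Ht. rewrite !x1_pos by lra. field; lra.
Qed.

Lemma top_merge_back K F F' j c d : natural_items K -> top_merge F F' ->
  In (c, d) (K (ftree F' j) (IZR j) (IZR j + 1)) -> j <> 0%Z ->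
  exists i, In (x1inv c, x1inv d) (K (ftree F i) (IZR i) (IZR i + 1)) /\
    x1inv ((c + d) / 2) = (x1inv c + x1inv d) / 2 /\ ftree F i = ftree F' j.
Proof.
  intros HK (_ & _ & _ & Hn & Hp) H n0.
  pose proof (proj2 HK _ _ _ _ _ (Rlt_plus_1 _) H) as B.
  destruct (Z.lt_total j 0) as [hj|[|hj]]; [|contradiction|].
  - pose proof (IZR_le (j + 1) 0) as hj'. rewrite plus_IZR in hj'.
    specialize (hj' ltac:(lia)). exists j. rewrite !x1inv_neg by lra.
    rewrite Hn in * by exact hj. auto.
  - pose proof (IZR_le 1 j ltac:(lia)). exists (j + 1)%Z. rewrite !x1inv_pos by lra.
    rewrite <- Hp by lia. split; [|split; [field|reflexivity]].
    pose proof (natural_translate K _ _ (j + 1) _ _ HK H) as G.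
    replace (IZR (j + 1 - j)) with 1 in G by (f_equal; lia). exact G.
Qed.

(** Between 0 and 2 the only space is the one at 1, which disappears. *)
Lemma top_merge_label F F' x : top_merge F F' -> x <= 0 \/ 2 <= x ->
  label_of F' (x1 x) = label_of F x.
Proof.
  intros HM Hx. symmetry. apply label_ext.
  - destruct Hx; [rewrite x1_neg by lra; tauto|rewrite x1_pos by lra].
    split; intros (i & E & Hi); apply IZR_le in Hi; lra.
  - intros _. pose proof HM as (E0 & E1 & E0' & _). split.
    + intros (c & i & H).
      destruct (top_merge_forth tcarets F F' i x c natural_carets HM H) as [[j Hj] _].
      * intros ->. rewrite E0 in H. destruct H.
      * intros ->. rewrite E1 in H. destruct H.
      * exists (x1 c), j. exact Hj.
    + intros (c & j & H).
      destruct (top_merge_back tcarets F F' j (x1 x) c natural_carets HM H) as (i & Hi & _).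
      * intros ->. rewrite E0' in H. destruct H.
      * rewrite x1inv_x1 in Hi. exists (x1inv c), i. exact Hi.
  - destruct Hx; [rewrite x1_neg by lra; tauto|rewrite x1_pos by lra].
    symmetry. apply (shift_exterior 1).
Qed.

Lemma cancelling_x1 D f : homeo f -> reduced_diagram_of D f -> x1_cancels D f ->
  (ell (fun t => x1 (f t)) < ell f)%nat.
Proof.
  intros Hf HD (E0 & E1 & a & b & Hab & Fa & Fm & Fb).
  destruct (forest_prune _ _ _ Hab) as (B' & N1 & PL & P3 & P4 & P5 & P6 & P7).
  destruct (top_merge_exists _ E0 E1) as (T' & HM & N2).
  pose proof HM as (_ & _ & E0' & _).
  pose proof (is_leaf_lt _ _ _ PL) as hab.
  set (m := (a + b) / 2) in *.
  assert (hm : a < m < b) by (unfold m; lra).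
  pose proof Hab as [i0 Hi0].
  assert (M1 : in_tree (dbot D) i0 a m) by apply (tecarets_halves _ _ _ _ _ Hi0).
  assert (M2 : in_tree (dbot D) i0 m b) by apply (tecarets_halves _ _ _ _ _ Hi0).
  assert (Nl : ftree (dbot D) i0 <> Leaf) by exact (tecarets_nonleaf _ _ _ _ Hi0).
  set (g := fun t => x1 (f t)).
  assert (Hg : homeo g) by exact (homeo_comp _ _ x1_homeo Hf).
  assert (Ga : g a = 0) by (unfold g; rewrite Fa, x1_neg; lra).
  assert (Gb : g b = 1) by (unfold g; rewrite Fb, x1_pos; lra).
  set (D' := {| dbot := B'; dtop := T' |}).
  assert (HD' : reduced_diagram_of D' g).
  { split.
    - intros c d Hcd. cbn [D' dbot dtop] in *. pose proof Hcd as [j Hj].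
      apply P3 in Hj as [[-> ->]|Hj].
      + rewrite Ga, Gb. split.
        * exists 0%Z. replace 1 with (0 + 1) by ring. apply (trivial_tree_leaf _ 0 E0').
        (* The halves of [[a, b]] have equal length and go to [[0, 1]] and [[1, 2]], so [f] is
           affine across the midpoint. *)
        * assert (X : forall t, a <= t <= b -> f t = 2 * ((t - a) / (b - a))).
          { intros t Ht. destruct (Rle_lt_dec t m).
            - rewrite (proj2 (proj1 HD a m (ex_intro _ i0 M1))) by lra.
              rewrite Fa, Fm. unfold m. field; lra.
            - rewrite (proj2 (proj1 HD m b (ex_intro _ i0 M2))) by lra.
              rewrite Fm, Fb. unfold m. field; lra. }
          intros t Ht. unfold g. rewrite x1_mid.
          -- rewrite X by exact Ht. field. lra.
          -- pose proof (proj1 (homeo_le f a t Hf) (proj1 Ht)).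
             pose proof (proj1 (homeo_le f t b Hf) (proj2 Ht)). lra.
      + assert (Hcd' : is_leaf (dbot D) c d) by (exists j; exact Hj).
        pose proof (is_leaf_lt _ _ _ Hcd') as hcd.
        (* The leaves matched with top trees 0 and 1 are the two halves of [[a, b]], which are no
           longer leaves of [B']; hence the image of [[c, d]] lies in another tree. *)
        destruct (proj1 HD _ _ Hcd') as [[k Hk] HL].
        pose proof (in_tree_bounds _ _ _ _ Hk).
        destruct (top_merge_forth tleaves (dtop D) T' k (f c) (f d) natural_leaves HM Hk)
          as [HX HA].
        * intros ->. apply in_trivial_tree in Hk as [Ec Ed]; [|exact E0].
          assert (c = a) by (apply (homeo_inj f); auto; lra).
          assert (d = m) by (apply (homeo_inj f); auto; lra). subst c d.
          destruct (leaf_overlap _ _ _ _ _ Hcd PL); lra.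
        * intros ->. apply in_trivial_tree in Hk as [Ec Ed]; [|exact E1].
          assert (c = m) by (apply (homeo_inj f); auto; lra).
          assert (d = b) by (apply (homeo_inj f); auto; lra). subst c d.
          destruct (leaf_overlap _ _ _ _ _ Hcd PL); lra.
        * split; [exact HX|]. apply (affine_comp f x1); auto. lra.
    - intros (c & d & c' & d' & Hcd & [j Hj] & G1 & G2 & G3). cbn [D' dbot dtop] in *.
      pose proof (tecarets_bounds _ _ _ _ _ (Rlt_plus_1 _) Hj).
      destruct (top_merge_back tecarets (dtop D) T' j c' d' natural_ecarets HM Hj)
        as (i & Hi & Hm & _).
      { intros ->. rewrite E0' in Hj. destruct Hj. }
      (* A newly exposed bottom caret has [[a, b]] as one half, which [g] maps onto an interval of
         length 1. An opposing top caret would have length 2, but carets lie in unit intervals. *)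
      apply P7 in Hcd as [Hcd|[[-> h2]|[h1 ->]]].
      + apply (proj2 HD). exists c, d, (x1inv c'), (x1inv d').
        split; [exact Hcd|]. split; [exists i; exact Hi|].
        rewrite <- Hm, <- G2, <- G1, <- G3. unfold g. rewrite !x1inv_x1. auto.
      + rewrite h2 in G2. lra.
      + rewrite h1 in G2. lra. }
  (* The only new required column is [[a, b]], and both of its halves were required before, so the
     support cannot grow. *)
  assert (HR : forall c d, required_col D' g c d -> (c = a /\ d = b) \/ required_col D f c d).
  { intros c d [(j & Hj & Hj')|(j & Hj & Hj')]; cbn [D' dbot dtop] in *.
    - apply P3 in Hj as [Hj|Hj]; [auto|right; left].
      exists j. split; [exact Hj|]. destruct Hj' as [h|h]; auto.
    - destruct (Z.eq_dec j 0) as [->|n].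
      + left. apply in_trivial_tree in Hj as [h1 h2]; [|exact E0'].
        split; apply (homeo_inj g); auto; lra.
      + right; right.
        destruct (top_merge_back tleaves (dtop D) T' j _ _ natural_leaves HM Hj n)
          as (i & Hi & _ & Ei).
        unfold g in Hi. rewrite !x1inv_x1 in Hi. exists i. split; [exact Hi|].
        rewrite Ei. destruct Hj' as [h|h]; [auto|contradiction]. }
  assert (R1 : required_col D f a m) by (left; exists i0; auto).
  assert (R2 : required_col D f m b) by (left; exists i0; auto).
  apply (ell_decreases D D'); auto; cbn [D' dbot dtop]; try lia.
  intros p ((q & Hq) & (a1 & b1 & Q1 & h1) & (a2 & b2 & Q2 & h2)). cbn [D' dbot dtop] in *.
  pose proof (is_leaf_lt _ _ _ Hq).
  split.
  - split; [|split].
    + destruct Hq as [j Hj]. apply P3 in Hj as [[_ ->]|Hj]; [exists m, i0; auto|exists q, j; auto].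
    + apply HR in Q1 as [[-> ->]|Q1]; [exists a, m|exists a1, b1]; auto.
    + apply HR in Q2 as [[-> ->]|Q2]; [exists m, b|exists a2, b2]; auto.
  - unfold space_weight. cbn [D' dbot dtop]. unfold g.
    rewrite (top_merge_label _ _ _ HM).
    2: { destruct (leaf_disjoint _ _ _ _ _ Hq PL) as [[_ ->]|[h|h]].
         - right. lra.
         - left. rewrite <- Fa. exact (proj1 (homeo_le f p a Hf) h).
         - right. rewrite <- Fb. apply (proj1 (homeo_le f b p Hf)). lra. }
    (* Pruning can alter the bottom label only at [a], where the top label is L. Bottom L depends on
       the position alone, and the other three bottom labels all give weight 1. *)
    destruct (Req_dec p a) as [->|n].
    + assert (E : label_of (dtop D) (f a) = LL).
      { rewrite Fa. unfold label_of. rewrite dec_true; [reflexivity|].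
        exists 0%Z. split; [reflexivity|lia]. }
      rewrite E. pose proof (left_exterior_exterior a).
      destruct (label_spec B' a) as [[-> h]|[[-> h]|[[-> h]|[-> h]]]];
        destruct (label_spec (dbot D) a) as [[-> h']|[[-> h']|[[-> h']|[-> h']]]];
        simpl; try lia; tauto.
    + replace (label_of B' p) with (label_of (dbot D) p); [lia|].
      apply label_ext; try tauto. intros _. split; intros [c Hc]; exists c.
      * apply P6 in Hc as [[h _]|Hc]; [contradiction|exact Hc].
      * apply P5, Hc.
Qed.

(** * A trivial current tree *)

(** The caret at [u] makes the bottom leaf [[u, v]] a left child, and since no caret starts at [v]
    its sibling is a leaf. No top caret at 1 means that tree 1 is trivial, so the sibling is matched
    with all of it. *)
Lemma cancel_of_labels D f u v : homeo f -> diagram_of D f ->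
  ftree (dtop D) 0 = Leaf -> f u = 0 -> f v = 1 -> is_leaf (dbot D) u v ->
  left_of_caret (dbot D) u -> ~ left_of_caret (dbot D) v -> ~ left_of_caret (dtop D) 1 ->
  x1_cancels D f.
Proof.
  intros Hf HD E0 Fu Fv Huv [c Hc] Nv N1.
  assert (E1 : ftree (dtop D) 1 = Leaf).
  { apply NNPP. intros n. apply N1. exists (1 + 1), 1%Z. apply tcarets_root, n. }
  destruct (caret_of_leaf _ _ _ _ Huv Hc) as (i & Hi & Hic & _).
  destruct (leaf_pair_ecaret _ _ _ _ _ (Rlt_plus_1 _) Hi) as (b & Hb & Ev); [eauto| |].
  { intros c' Hc'. apply Nv. exists c', i. exact Hc'. }
  split; [exact E0|]. split; [exact E1|]. exists u, b. rewrite <- Ev.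
  split; [exists i; exact Hb|]. split; [exact Fu|]. split; [exact Fv|].
  destruct (tecarets_halves _ _ _ _ _ Hb) as [_ Hvb]. rewrite <- Ev in Hvb.
  destruct (HD _ _ (ex_intro _ i Hvb)) as [Hl _]. rewrite Fv in Hl.
  pose proof (is_leaf_lt _ _ _ Hl).
  assert (L1 : is_leaf (dtop D) 1 (1 + 1)) by exact (ex_intro _ 1%Z (trivial_tree_leaf _ 1 E1)).
  destruct (leaf_overlap _ _ _ _ _ Hl L1); lra.
Qed.

Lemma trivial_diagram_identity D f : diagram_of D f -> f 0 = 0 ->
  (forall i, ftree (dbot D) i = Leaf) -> (forall i, ftree (dtop D) i = Leaf) ->
  forall t, f t = t.
Proof.
  intros HD F0 Hb Ht.
  assert (Hsucc : forall i k, f (IZR i) = IZR k -> f (IZR i + 1) = IZR k + 1).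
  { intros i k E. destruct (HD _ _ (ex_intro _ i (trivial_tree_leaf _ _ (Hb i)))) as [[j Hj] _].
    apply in_trivial_tree in Hj as [E1 E2]; [|apply Ht]. rewrite E2.
    rewrite E in E1. rewrite E1. reflexivity. }
  assert (Hpred : forall i k, f (IZR i + 1) = IZR k + 1 -> f (IZR i) = IZR k).
  { intros i k E. destruct (HD _ _ (ex_intro _ i (trivial_tree_leaf _ _ (Hb i)))) as [[j Hj] _].
    apply in_trivial_tree in Hj as [E1 E2]; [|apply Ht]. rewrite E1. lra. }
  assert (Hpos : forall n : nat, f (IZR (Z.of_nat n)) = IZR (Z.of_nat n)).
  { induction n as [|n IH]; [exact F0|].
    rewrite Nat2Z.inj_succ, succ_IZR. apply Hsucc, IH. }
  assert (Hneg : forall n : nat, f (IZR (- Z.of_nat n)) = IZR (- Z.of_nat n)).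
  { induction n as [|n IH]; [exact F0|].
    apply Hpred. rewrite <- plus_IZR.
    replace (- Z.of_nat (S n) + 1)%Z with (- Z.of_nat n)%Z by lia. exact IH. }
  assert (Hz : forall i, f (IZR i) = IZR i).
  { intros i. destruct (Z.le_ge_cases 0 i).
    - specialize (Hpos (Z.to_nat i)). rewrite Z2Nat.id in Hpos by lia. exact Hpos.
    - specialize (Hneg (Z.to_nat (- i))). rewrite Z2Nat.id, Z.opp_involutive in Hneg by lia.
      exact Hneg. }
  intros t. destruct (unit_cover_l t) as [i Hi].
  rewrite (proj2 (HD _ _ (ex_intro _ i (trivial_tree_leaf _ _ (Hb i))))) by lra.
  rewrite (Hsucc i i (Hz i)), Hz. field. lra.
Qed.

(** The first and the last leaf of a required tree are both required. If they coincide the tree is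
    trivial, and a nontrivial tree anywhere would contradict this. *)
Lemma single_required_trivial F u v :
  (forall i a b, in_tree F i a b -> ftree F i <> Leaf \/ i = 0%Z -> a = u /\ b = v) ->
  u = 0 /\ v = 1 /\ forall i, ftree F i = Leaf.
Proof.
  intros H.
  assert (T : forall i, ftree F i <> Leaf \/ i = 0%Z -> u = IZR i /\ ftree F i = Leaf).
  { intros i Hi.
    destruct (tleaves_cover_l (ftree F i) (IZR i) (IZR i + 1) (IZR i)) as (a & b & Ha & h); [lra|].
    destruct (tleaves_cover_r (ftree F i) (IZR i) (IZR i + 1) (IZR i + 1)) as (a' & b' & Ha' & h'); [lra|].
    destruct (H i a b Ha Hi), (H i a' b' Ha' Hi). subst a b a' b'.
    pose proof (tleaves_bounds _ _ _ _ _ (Rlt_plus_1 _) Ha).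
    assert (u = IZR i) by lra. assert (v = IZR i + 1) by lra.
    split; [assumption|]. apply (tleaves_full _ (IZR i) (IZR i + 1)); [lra|]. subst u v. exact Ha. }
  destruct (T 0%Z) as [Eu E0]; [auto|].
  destruct (H 0%Z 0 (0 + 1)) as [_ Ev]; [apply (trivial_tree_leaf _ 0 E0)|auto|].
  split; [exact Eu|]. split; [lra|]. intros i. apply NNPP. intros n.
  apply n, T. auto.
Qed.

Lemma trivial_column_not_required D f h k u v : (forall t, h t = t - IZR k) -> k <> 0%Z ->
  ftree (dtop D) 0 = Leaf -> f u = 0 -> f v = 1 ->
  (forall i, in_tree (dbot D) i u v -> ftree (dbot D) i = Leaf /\ i <> 0%Z) ->
  ~ required_col (shift_top k D) (fun t => h (f t)) u v.
Proof.
  intros Hh Hk E0 Fu Fv HB HR.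
  apply required_shift in HR as [(i & Hi & Hi')|(i & Hi & Hi')]; [| |exact Hh].
  - destruct (HB i Hi). tauto.
  - rewrite Fu, Fv in Hi. replace 1 with (IZR 0 + 1) in Hi by (simpl; ring).
    apply (in_tree_full _ i 0) in Hi as [-> _]. destruct Hi'; [contradiction|congruence].
Qed.

Lemma current_tree_trivial D f : homeo f -> reduced_diagram_of D f ->
  ~ (forall t, f t = t) -> ftree (dtop D) 0 = Leaf -> ~ x1_cancels D f ->
  (ell (fun t => x0 (f t)) < ell f)%nat \/ (ell (fun t => x0inv (f t)) < ell f)%nat.
Proof.
  intros Hf HD Hid E0 Hnc.
  assert (L01 : is_leaf (dtop D) 0 1).
  { exists 0%Z. replace 1 with (0 + 1) by ring. apply (trivial_tree_leaf _ 0 E0). }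
  destruct (top_leaf_preimage _ _ _ _ (proj1 HD) Hf L01) as (u & v & Huv & Fu & Fv).
  pose proof (is_leaf_lt _ _ _ Huv) as huv.
  assert (Ruv : required_col D f u v).
  { right. exists 0%Z. rewrite Fu, Fv. split; [|auto].
    replace 1 with (0 + 1) by ring. apply (trivial_tree_leaf _ 0 E0). }
  pose proof (leaf_at_start _ _ _ Huv) as Su.
  assert (Sv : exists a, is_leaf (dbot D) a v) by eauto.
  assert (Hcancel : left_of_caret (dbot D) u -> label_of (dbot D) v = II ->
    left_of_caret (dtop D) 1).
  { intros Hu Hv. apply NNPP. intros N1. apply Hnc.
    apply (cancel_of_labels D f u v); auto; [apply HD|].
    destruct (label_spec (dbot D) v) as [h|[h|[h|h]]]; intuition congruence. }
  assert (RL : forall a b, required_col D f a b -> is_leaf (dbot D) a b).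
  { intros a b. apply required_col_leaf; [exact Hf|apply HD]. }
  assert (Hh0 : forall t, x0 t = t - IZR 1) by reflexivity.
  assert (Hh0' : forall t, x0inv t = t - IZR (-1)) by (intros; unfold x0inv; simpl; ring).
  destruct (classic (support_space D f u)) as [Hu|Hu].
  - pose proof (move_left D f x0inv u Hf HD (fun t => eq_refl) Fu E0 Hu) as ML.
    destruct (classic (support_space D f v)) as [Hv|Hv].
    + pose proof (move_right D f x0 v Hf HD (fun t => eq_refl) Fv Hv) as MR.
      (* When the bottom label at [u] is N or R, the hypothesis for moving right holds at [v]. For
         N, the space [v] is interior, and if it is labelled I the failure to cancel provides a top
         caret at 1. For R, [[u, v]] is a trivial tree right of the pointer, so [v] is a positive
         integer. *)
      assert (Hdone : (left_of_caret (dbot D) u -> ~ exterior v) -> label_of (dbot D) u = NN \/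
        label_of (dbot D) u = RR -> label_of (dbot D) v <> LL /\
        (left_of_caret (dtop D) 1 \/ label_of (dbot D) v <> II)).
      { intros Hext Hlu.
        destruct (label_spec (dbot D) u) as [[h _]|[[_ [_ h]]|[[_ [h1 [h2 h3]]]|[h _]]]];
          [intuition congruence| | |intuition congruence].
        - split.
          + intros hv. apply Hext; [exact h|]. apply left_exterior_exterior.
            destruct (label_spec (dbot D) v) as [g|[g|[g|g]]]; intuition congruence.
          + destruct (classic (label_of (dbot D) v = II)); auto.
        - destruct h3 as [j ->]. rewrite left_exterior_IZR in h1.
          assert (Ej : ftree (dbot D) j = Leaf).
          { apply NNPP. intros n. apply h2. exists (IZR j + 1), j. apply tcarets_root, n. }
          destruct (leaf_overlap _ _ _ _ _ Huv (ex_intro _ j (trivial_tree_leaf _ _ Ej)))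
            as [_ Ev]; [lra|lra|].
          rewrite <- plus_IZR in Ev.
          destruct (label_spec (dbot D) v) as [[g g']|[[g g']|[[g g']|[g g']]]].
          + rewrite Ev in g'. apply left_exterior_IZR in g'. lia.
          + rewrite g. split; [discriminate|right; discriminate].
          + rewrite g. split; [discriminate|right; discriminate].
          + exfalso. apply g'. exists (j + 1)%Z. exact Ev. }
      assert (Hext : left_of_caret (dbot D) u -> ~ exterior v).
      { intros [c Hc] [j Ej].
        destruct (caret_of_leaf _ _ _ _ Huv Hc) as (i & Hi & Hic & hvc).
        apply in_tree_bounds in Hi. apply tcarets_bounds in Hic; [|lra].
        assert (i < j)%Z by (apply lt_IZR; lra).
        assert (IZR (i + 1) <= IZR j) by (apply IZR_le; lia). rewrite plus_IZR in *. lra. }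
      destruct (label_spec (dbot D) u) as [[h _]|[[h _]|[[h _]|[h _]]]].
      * right. auto.
      * left. apply MR. right. auto.
      * left. apply MR. right. auto.
      * right. auto.
    (* Here [[u, v]] is the last column of the support. Bottom label N at [u] is impossible, since
       the caret would have required leaves beyond [v]. With R the column ceases to be required
       after the move, and [u] leaves the support. *)
    + right. apply ML.
      destruct (label_spec (dbot D) u) as [[h _]|[[h [_ hc]]|[[h [h1 [h2 [j Ej]]]]|[h _]]]]; auto.
      * exfalso. destruct hc as [c Hc].
        destruct (caret_of_leaf _ _ _ _ Huv Hc) as (i & Hi & Hic & hvc).
        apply Hv. split; [exact Sv|]. split; [exists u, v; auto|].
        pose proof (tcarets_bounds _ _ _ _ _ (Rlt_plus_1 _) Hic).
        destruct (tleaves_cover_l (ftree (dbot D) i) (IZR i) (IZR i + 1) v) as (a & b & Hab & hh).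
        { apply in_tree_bounds in Hi. lra. }
        exists a, b. split; [|lra]. left. exists i. split; [exact Hab|].
        left. exact (tcarets_nonleaf _ _ _ _ Hic).
      * do 2 right. intros (_ & _ & (a2 & b2 & R2 & hb)).
        assert (Eab : a2 = u /\ b2 = v).
        { apply required_shift_old in R2 as [R2|[_ Eb]]; [| |exact Hh0'].
          - assert (b2 <= v).
            { apply Rnot_lt_le. intros n. apply Hv. split; [exact Sv|].
              split; [exists u, v|exists a2, b2]; auto. }
            pose proof (RL _ _ R2) as L2. pose proof (is_leaf_lt _ _ _ L2).
            apply (leaf_overlap (dbot D)); auto; lra.
          - apply (homeo_lt f) in hb; [|exact Hf]. simpl in Eb. lra. }
        destruct Eab as [-> ->].
        apply (trivial_column_not_required D f x0inv (-1) u v); auto; [lia|].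
        subst u. rewrite left_exterior_IZR in h1.
        assert (Ej : ftree (dbot D) j = Leaf).
        { apply NNPP. intros n. apply h2. exists (IZR j + 1), j. apply tcarets_root, n. }
        intros i Hi. pose proof (trivial_tree_leaf _ _ Ej) as Hj.
        destruct (in_tree_disjoint _ _ _ _ _ _ _ Hi Hj) as [[-> _]|[n|n]]; [|lra|lra].
        split; [exact Ej|lia].
  - left.
    (* From here on [[u, v]] is the first column of the support. *)
    assert (Hmin : forall a b, required_col D f a b -> u <= a).
    { intros a b R. apply Rnot_lt_le. intros n. apply Hu. split; [exact Su|].
      split; [exists a, b|exists u, v]; auto. }
    assert (Hfirst : forall i, in_tree (dbot D) i u v ->
      ftree (dbot D) i <> Leaf \/ i = 0%Z -> u = IZR i).
    { intros i Hi Hi'.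
      destruct (tleaves_cover_l (ftree (dbot D) i) (IZR i) (IZR i + 1) (IZR i))
        as (a & b & Hab & hab); [lra|].
      assert (u <= a) by (apply (Hmin a b); left; exists i; auto).
      apply in_tree_bounds in Hi. lra. }
    destruct (classic (support_space D f v)) as [Hv|Hv].
    + apply (move_right D f x0 v Hf HD Hh0 Fv Hv).
      destruct (label_spec (dbot D) v) as [[h hl]|[[h _]|[[h _]|[h [hc he]]]]].
      (* As [v] is an integer at most 0, the bottom tree ending there is unmarked. It is also
         trivial, for otherwise its first leaf, being required, would be [[u, v]] and fill the tree.
         So the column is no longer required once the pointer has moved. *)
      * left. split; [exact h|]. destruct hl as (j & Ej & Hj).
        intros (_ & (a1 & b1 & R1 & ha) & _).
        assert (Eab : a1 = u /\ b1 = v).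
        { pose proof R1 as R1'. apply required_shift_old in R1 as [R1|[Ea _]]; [| |exact Hh0].
          - pose proof (Hmin _ _ R1). pose proof (RL _ _ R1) as L1.
            pose proof (is_leaf_lt _ _ _ L1).
            apply (leaf_overlap (dbot D)); auto; lra.
          - apply (homeo_lt f) in ha; [|exact Hf]. lra. }
        destruct Eab as [-> ->].
        apply (trivial_column_not_required D f x0 1 u v); auto; [lia|].
        intros i Hi. pose proof (in_tree_bounds _ _ _ _ Hi) as B.
        assert (i < j)%Z by (apply lt_IZR; lra).
        assert (IZR (i + 1) <= IZR j) by (apply IZR_le; lia). rewrite plus_IZR in *.
        assert (Ev : v = IZR i + 1) by lra.
        split; [|lia]. apply NNPP. intros n.
        rewrite (Hfirst i Hi (or_introl n)), Ev in Hi.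
        apply (in_tree_full _ i i) in Hi. tauto.
      * right. rewrite h. split; [discriminate|right; discriminate].
      * right. rewrite h. split; [discriminate|right; discriminate].
      (* An interior [v] makes the bottom tree nontrivial. Its first leaf is then [[u, v]], so its
         root caret starts at [u] and the failure to cancel yields a top caret at 1. *)
      * right. rewrite h. split; [discriminate|left].
        apply Hcancel; [|exact h]. destruct Huv as [i Hi].
        assert (n : ftree (dbot D) i <> Leaf).
        { intros E. apply in_trivial_tree in Hi as [_ Ev]; [|exact E].
          apply he. exists (i + 1)%Z. rewrite plus_IZR. exact Ev. }
        rewrite (Hfirst i Hi (or_introl n)). exists (IZR i + 1), i. apply tcarets_root, n.
    (* With neither space in the support, [[u, v]] is the only required column. Both forests are
       then trivial and [u] is 0, which forces the identity. *)
    + exfalso. apply Hid.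
      assert (Honly : forall a b, required_col D f a b -> a = u /\ b = v).
      { intros a b R. pose proof (Hmin _ _ R). pose proof (RL _ _ R) as L.
        pose proof (is_leaf_lt _ _ _ L).
        assert (b <= v).
        { apply Rnot_lt_le. intros n. apply Hv. split; [exact Sv|].
          split; [exists u, v|exists a, b]; auto. }
        apply (leaf_overlap (dbot D)); auto; lra. }
      destruct (single_required_trivial (dbot D) u v) as (Eu & _ & HB).
      { intros i a b Hi Hi'. apply Honly. left. exists i. auto. }
      destruct (single_required_trivial (dtop D) 0 1) as (_ & _ & HT).
      { intros i a b Hi Hi'.
        destruct (top_leaf_preimage _ _ a b (proj1 HD) Hf) as (a' & b' & _ & Ea & Eb);
          [exists i; exact Hi|].
        destruct (Honly a' b') as [-> ->]; [right; exists i; subst; auto|]. lra. }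
      rewrite Eu in Fu. exact (trivial_diagram_identity D f (proj1 HD) Fu HB HT).
Qed.

Theorem theorem4p3p7 (f : R -> R) (hF : inF f) (hid : ~ (forall t, f t = t))
  (D : fdiag) (hD : reduced_diagram_of D f) :
  (ftree (dtop D) 0 <> Leaf ->
     (ell (fun t => x1inv (f t)) < ell f)%nat \/ (ell (fun t => x0 (f t)) < ell f)%nat) /\
  (x1_cancels D f -> (ell (fun t => x1 (f t)) < ell f)%nat) /\
  (ftree (dtop D) 0 = Leaf -> ~ x1_cancels D f ->
     (ell (fun t => x0 (f t)) < ell f)%nat \/ (ell (fun t => x0inv (f t)) < ell f)%nat).
Proof.
  pose proof (diagram_homeo D f hF (proj1 hD)) as Hf.
  split; [|split].
  - exact (current_tree_nontrivial D f Hf hD).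
  - exact (cancelling_x1 D f Hf hD).
  - exact (current_tree_trivial D f Hf hD hid).
Qed.
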